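(* Let $n\ge 1$ and $N\ge 1$ be integers and let $g\colon(0,\infty)\to\mathbb{R}$ be a function. Suppose there is a Borel-measurable function $\hat\theta\colon(\mathbb{S}^{n-1})^N\to\mathbb{R}$ such that $\mathbb{E}_{\mu,\kappa}[|\hat\theta|]<\infty$ and $\mathbb{E}_{\mu,\kappa}[\hat\theta]=g(\kappa)$ for all $(\mu,\kappa)\in\mathbb{S}^{n-1}\times(0,\infty)$. Then there exists a real-analytic function $h$ on an open neighborhood of $[0,\infty)$ in $\mathbb{R}$ such that $g(\kappa)=h(\kappa^2)$ for all $\kappa>0$.
   Context: $\mathbb{S}^{n-1}=\{x\in\mathbb{R}^n:\|x\|=1\}$ and $\sigma$ is its surface measure (the $(n-1)$-dimensional Hausdorff measure); for $n=1$, $\mathbb{S}^0=\{-1,+1\}$ and $\sigma$ is counting measure. For $\mu\in\mathbb{S}^{n-1}$ and $\kappa>0$, the Fisher--von Mises--Langevin distribution $\mathrm{FvML}(\mu,\kappa)$ is the probability measure on $\mathbb{S}^{n-1}$ with density with respect to $\sigma$ $$f(x;\mu,\kappa)=C_n(\kappa)\,e^{\kappa\mu^\top x},\qquad C_n(\kappa)=\frac{\kappa^{n/2-1}}{(2\pi)^{n/2}I_{n/2-1}(\kappa)},$$ where $I_\nu(\kappa)=\sum_{m\ge0}\frac{(\kappa/2)^{\nu+2m}}{m!\,\Gamma(\nu+m+1)}$ is the modified Bessel function of the first kind. $C_n(\kappa)$ is the normalizing constant. $\mathbb{E}_{\mu,\kappa}$ denotes expectation under the $N$-fold product measure $P_{\mu,\kappa}^{\otimes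 N}$ on $(\mathbb{S}^{n-1})^N$ (the law of $N$ i.i.d. $\mathrm{FvML}(\mu,\kappa)$ observations), whose density with respect to $\sigma^{\otimes N}$ is $C_n(\kappa)^N\exp(\kappa\mu^\top\sum_{i=1}^N x_i)$. *)

(* Defs.v *)
From HB Require Import structures.
From mathcomp Require Import all_boot all_order all_algebra.
From mathcomp Require Import all_classical all_reals all_analysis.
From mathcomp Require Import measurable_realfun.
From mathcomp Require Import ring lra.

Set Implicit Arguments.
Unset Strict Implicit.
Unset Printing Implicit Defensive.
Import Order.TTheory GRing.Theory Num.Theory.
Import numFieldNormedType.Exports.

Local Open Scope classical_set_scope.
Local Open Scope ring_scope.

Section borel_matrix.
Context {R : realType} (m n : nat).

HB.instance Definition _ := @isMeasurable.Build
  (sigma_display (open : set (set 'M[R]_(m, n)))) 'M[R]_(m, n)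
  <<s open >> (@sigma_algebra0 _ setT open) (@sigma_algebraC _ open)
  (@sigma_algebra_bigcup _ setT open).

End borel_matrix.

Section euclidean.
Context {R : realType} {n : nat}.
Implicit Types x y : 'rV[R]_n.

Definition dotp x y : R := \sum_(i < n) x 0 i * y 0 i.

(* The library norm [`|x|] on matrices is the maximum norm, which induces the
   same topology. *)
Definition enorm x : R := Num.sqrt (dotp x x).

Definition sphere : set 'rV[R]_n := [set x | enorm x = 1].

Definition ediam (A : set 'rV[R]_n) : \bar R :=
  ereal_sup [set (enorm (x - y))%:E | x in A & y in A].

End euclidean.
Arguments sphere : clear implicits.

Definition Gamma {R : realType} (z : R) : R :=
  (\int[lebesgue_measure]_(t in `]0, +oo[) (t `^ (z - 1) * expR (- t)))%R.

Section hausdorff.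
Context {R : realType} {n : nat}.
Variable s : nat.
Implicit Types (A : set 'rV[R]_n) (delta : R).

(* Volume of the ball of diameter 1 in dimension s: with this factor the
   s-dimensional Hausdorff measure is s-dimensional area, and it is the counting
   measure for s = 0. *)
Definition hausdorff_cst : R :=
  pi `^ (s%:R / 2) / Gamma (s%:R / 2 + 1) / 2 ^+ s.

(* A nonempty set of diameter 0 has weight 1 when s = 0. *)
Definition hausdorff_weight A : \bar R :=
  if A == set0 then 0%E else (hausdorff_cst%:E * ediam A ^+ s)%E.

Definition hausdorff_pre delta A : \bar R :=
  ereal_inf [set (\sum_(k <oo) hausdorff_weight (U k))%E |
    U in [set U : (set 'rV[R]_n)^nat |
      A `<=` \bigcup_k U k /\ forall k, (ediam (U k) <= delta%:E)%E]].

Definition hausdorff A : \bar R :=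
  ereal_sup [set hausdorff_pre delta A | delta in [set delta : R | 0 < delta]].

End hausdorff.

Section ediam_theory.
Context {R : realType} {n : nat}.
Implicit Types x y : 'rV[R]_n.

Lemma le_ediam (A B : set 'rV[R]_n) : A `<=` B -> (ediam A <= ediam B)%E.
Proof.
move=> AB; apply: ge_ereal_sup => _ [x Ax [y Ay <-]].
by apply: ereal_sup_ubound; exists x; [exact: AB|exists y => //; exact: AB].
Qed.

Lemma enorm_ge0 x : 0 <= enorm x. Proof. exact: sqrtr_ge0. Qed.

Lemma enorm_le_ediam (A : set 'rV[R]_n) x y : A x -> A y ->
  ((enorm (x - y))%:E <= ediam A)%E.
Proof. by move=> Ax Ay; apply: ereal_sup_ubound; exists x => //; exists y. Qed.

Lemma ediam_ge0 (A : set 'rV[R]_n) : A !=set0 -> (0 <= ediam A)%E.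
Proof.
by move=> [x Ax]; rewrite (le_trans _ (enorm_le_ediam Ax Ax))// lee_fin enorm_ge0.
Qed.

Lemma ediam0 : ediam (@set0 'rV[R]_n) = -oo%E.
Proof.
rewrite /ediam (_ : [set _ | _ in _ & _ in _] = set0) ?ereal_sup0//.
by rewrite -subset0 => ? [].
Qed.

Lemma dotp_ge0 x : 0 <= dotp x x.
Proof. by apply: sumr_ge0 => i _; rewrite -expr2 sqr_ge0. Qed.

Lemma enorm_sqr x : enorm x ^+ 2 = dotp x x.
Proof. by rewrite sqr_sqrtr// dotp_ge0. Qed.

Lemma mxnorm_le_enorm x : `|x| <= enorm x.
Proof.
rewrite [leLHS]/Num.norm/= mx_normrE; apply: bigmax_le; first exact: enorm_ge0.
move=> [i j] _ /=; rewrite -sqrtr_sqr ler_sqrt ?dotp_ge0//.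
rewrite /dotp (bigD1 j)//= (ord1 i) -expr2 lerDl.
by apply: sumr_ge0 => k _; rewrite -expr2 sqr_ge0.
Qed.

Lemma enormN x : enorm (- x) = enorm x.
Proof.
by rewrite /enorm; congr Num.sqrt; apply: eq_bigr => i _; rewrite !mxE mulrNN.
Qed.

Lemma enormB x y : enorm (x - y) = enorm (y - x).
Proof. by rewrite -enormN opprB. Qed.

Lemma dotpDl x y z : dotp (x + y) z = dotp x z + dotp y z.
Proof. by rewrite -big_split; apply: eq_bigr => i _; rewrite !mxE mulrDl. Qed.

Lemma dotpC x y : dotp x y = dotp y x.
Proof. by apply: eq_bigr => i _; rewrite mulrC. Qed.

Lemma dotpZl a x y : dotp (a *: x) y = a * dotp x y.
Proof. by rewrite mulr_sumr; apply: eq_bigr => i _; rewrite !mxE mulrA. Qed.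

Lemma dotp_le x y : dotp x y <= enorm x * enorm y.
Proof.
have [y0|yn0] := eqVneq (enorm y) 0.
  have yE j : y 0 j = 0.
    have /eqP := enorm_sqr y; rewrite y0 expr0n/= eq_sym psumr_eq0.
      by move=> /allP/(_ j (mem_index_enum _)); rewrite mulf_eq0 orbb => /eqP.
    by move=> i _; rewrite -expr2 sqr_ge0.
  by rewrite y0 mulr0 /dotp big1// => i _; rewrite yE mulr0.
have ygt0 : 0 < enorm y by rewrite lt0r yn0 enorm_ge0.
have [x0|xn0] := eqVneq (enorm x) 0.
  have xE j : x 0 j = 0.
    have /eqP := enorm_sqr x; rewrite x0 expr0n/= eq_sym psumr_eq0.
      by move=> /allP/(_ j (mem_index_enum _)); rewrite mulf_eq0 orbb => /eqP.
    by move=> i _; rewrite -expr2 sqr_ge0.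
  by rewrite x0 mul0r /dotp big1// => i _; rewrite xE mul0r.
have xgt0 : 0 < enorm x by rewrite lt0r xn0 enorm_ge0.
have := dotp_ge0 (enorm y *: x - enorm x *: y).
rewrite -scaleNr dotpDl !dotpZl !(dotpC _ (_ + _)) !dotpDl !dotpZl.
rewrite (dotpC y x) -!enorm_sqr.
set a := enorm x; set b := enorm y; set c := dotp x y.
rewrite (_ : _ + _ = 2 * (a * b) * (a * b - c)); last by ring.
by rewrite pmulr_rge0 ?subr_ge0// mulr_gt0// mulr_gt0.
Qed.

Lemma enormD x y : enorm (x + y) <= enorm x + enorm y.
Proof.
rewrite -(@ler_pXn2r _ 2)// ?nnegrE ?addr_ge0 ?enorm_ge0//.
rewrite sqrrD !enorm_sqr dotpDl !(dotpC _ (_ + _)) !dotpDl (dotpC y x).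
have := dotp_le x y; set c := dotp x y; set e := _ * _ => ce.
by rewrite mulr2n; lra.
Qed.

Lemma enorm_triangle y x z : enorm (x - z) <= enorm (x - y) + enorm (y - z).
Proof. by rewrite (le_trans _ (enormD _ _))// addrA subrK. Qed.

End ediam_theory.
Section hausdorff_theory.
Context {R : realType} {n : nat} (s : nat).
Local Open Scope ereal_scope.
Implicit Types (A B : set 'rV[R]_n) (delta : R).

Lemma Gamma_ge0 (z : R) : (0 <= Gamma z)%R.
Proof. by apply: Rintegral_ge0 => // t _; rewrite mulr_ge0 ?powR_ge0 ?expR_ge0. Qed.

Lemma hausdorff_cst_ge0 : (0 <= hausdorff_cst s :> R)%R.
Proof. by rewrite !divr_ge0 ?powR_ge0 ?Gamma_ge0 ?exprn_ge0. Qed.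

Lemma hausdorff_weight0 : hausdorff_weight s (@set0 'rV[R]_n) = 0.
Proof. by rewrite /hausdorff_weight eqxx. Qed.

Lemma hausdorff_weight_ge0 A : 0 <= hausdorff_weight s A.
Proof.
rewrite /hausdorff_weight; case: ifPn => // /set0P A0.
by rewrite mule_ge0 ?expe_ge0 ?ediam_ge0// lee_fin hausdorff_cst_ge0.
Qed.

Lemma le_hausdorff_weight A B : A `<=` B ->
  hausdorff_weight s A <= hausdorff_weight s B.
Proof.
move=> AB; have [->|A0] := eqVneq A set0.
  by rewrite hausdorff_weight0 hausdorff_weight_ge0.
have B0 : B != set0 by apply: contra_neq A0 => B0; rewrite -subset0 -B0.
rewrite /hausdorff_weight (negbTE A0) (negbTE B0).
rewrite lee_wpmul2l ?lee_fin ?hausdorff_cst_ge0//.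
have := le_ediam AB; have : 0 <= ediam A by apply: ediam_ge0; exact/set0P.
move: (ediam A) (ediam B) => a b a0 ab.
elim: s => [|k ih]; first by rewrite !expe0.
by rewrite !expeS lee_pmul ?expe_ge0.
Qed.

Lemma hausdorff_pre_ge0 delta A : 0 <= hausdorff_pre s delta A.
Proof.
apply: le_ereal_inf_tmp => _ [U _ <-]; apply: nneseries_ge0 => k _ _.
exact: hausdorff_weight_ge0.
Qed.

Lemma le_hausdorff_pre delta A B : A `<=` B ->
  hausdorff_pre s delta A <= hausdorff_pre s delta B.
Proof.
move=> AB; apply/ereal_inf_le_tmp => x [U [BU dU] <-].
by exists U => //; split => //; exact: subset_trans AB BU.
Qed.

Lemma hausdorff_pre_anti delta1 delta2 A : (delta1 <= delta2)%R ->
  hausdorff_pre s delta2 A <= hausdorff_pre s delta1 A.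
Proof.
move=> d12; apply/ereal_inf_le_tmp => x [U [AU dU] <-].
by exists U => //; split => // k; rewrite (le_trans (dU k))// lee_fin.
Qed.

Lemma hausdorff_pre_le_weight delta A : ediam A <= delta%:E ->
  hausdorff_pre s delta A <= hausdorff_weight s A.
Proof.
move=> dA; apply: ereal_inf_lbound.
exists (fun k : nat => if k is 0%N return set 'rV[R]_n then A else set0).
  split=> [x Ax|[|k]//]; first by exists 0%N.
  by rewrite ediam0 leNye.
rewrite nneseries_recl//; last by move=> *; rewrite hausdorff_weight_ge0.
rewrite eseries_cond/= eseries0 ?adde0// => -[|]//= k _ _.
exact: hausdorff_weight0.
Qed.

Lemma hausdorff_pre0 delta : hausdorff_pre s delta (@set0 'rV[R]_n) = 0.
Proof.
apply/eqP; rewrite eq_le hausdorff_pre_ge0 andbT -hausdorff_weight0.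
by apply: hausdorff_pre_le_weight; rewrite ediam0 leNye.
Qed.

Lemma hausdorff_pre_sigma_subadditive delta :
  sigma_subadditive (@hausdorff_pre R n s delta).
Proof.
move=> A.
have [[i ioo]|] := pselect (exists i, hausdorff_pre s delta (A i) = +oo).
  rewrite (eseries_pinfty _ _ ioo) ?leey// => k _.
  by rewrite -ltNye (lt_le_trans _ (hausdorff_pre_ge0 _ _)).
rewrite -forallNE => Aoo.
suff add2e (e : {posnum R}) : hausdorff_pre s delta (\bigcup_n A n) <=
    \sum_(i <oo) hausdorff_pre s delta (A i) + e%:num%:E.
  by apply/lee_addgt0Pr => _/posnumP[].
rewrite (le_trans _ (epsilon_trick _ _ _))//; last first.
  by move=> k; exact: hausdorff_pre_ge0.
pose P k (U : (set 'rV[R]_n)^nat) :=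
  [/\ A k `<=` \bigcup_j U j, forall j, ediam (U j) <= delta%:E &
  \sum_(j <oo) hausdorff_weight s (U j) <=
    hausdorff_pre s delta (A k) + (e%:num / (2 ^ k.+1)%:R)%:E].
have [G PG] : {G : ((set 'rV[R]_n)^nat)^nat & forall k, P k (G k)}.
  apply: (@choice _ _ P) => k.
  have : hausdorff_pre s delta (A k) \is a fin_num.
    by rewrite ge0_fin_numE ?hausdorff_pre_ge0// ltey; exact/eqP.
  move=> /(@lb_ereal_inf_adherent _ _ (e%:num / (2 ^ k.+1)%:R)).
  have e0 : (0 < e%:num / (2 ^ k.+1)%:R)%R by [].
  by move=> /(_ e0)[_ [U [AU dU] <-] /ltW]; exists U.
have G_ge0 x : 0 <= (hausdorff_weight s \o uncurry G) x.
  exact: hausdorff_weight_ge0.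
apply: (@le_trans _ _ (\esum_(i in setT) (hausdorff_weight s \o uncurry G) i)).
  apply: ereal_inf_lbound => /=.
  have /card_esym/ppcard_eqP[f] := card_nat2.
  exists (uncurry G \o f).
    split => [|i]; last first.
      by rewrite /= /uncurry; case: (f i) => a b; have [_ + _] := PG a; exact.
    move=> t [i _ Ait]; have [+ _ _] := PG i => /(_ _ Ait)[j _ Gijt].
    by exists (f^-1%FUN (i, j)) => //=; rewrite invK ?inE.
  rewrite -(esum_pred_image (hausdorff_weight s \o uncurry G) _ xpredT)//
    ?[fun=> _]set_true//.
  by rewrite image_eq.
rewrite (_ : esum _ _ =
    \sum_(i <oo) \sum_(j <oo) hausdorff_weight s (G i j)); last first.
  pose J : nat -> set (nat * nat) := fun i => [set (i, j) | j in setT].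
  rewrite (_ : setT = \bigcup_k J k); last first.
    by rewrite predeqE => -[a b]; split => // _; exists a => //; exists b.
  rewrite esum_bigcupT /=; last 2 first.
    - apply/trivIsetP => i j _ _ ij.
      rewrite predeqE => -[a b] /=; split => //= -[] [_] _ [<-{a} _].
      by move=> [m' _] [] /esym/eqP; rewrite (negbTE ij).
    - by move=> /= [a b]; exact: hausdorff_weight_ge0.
  rewrite -(image_id [set: nat]) -fun_true esum_pred_image//; last first.
    by move=> k _; apply: esum_ge0 => t _; exact: hausdorff_weight_ge0.
  apply: eq_eseriesr => /= j _.
  rewrite -(esum_pred_image (hausdorff_weight s \o uncurry G) (pair j) predT)//=.
  - by congr esum; rewrite predeqE => -[a b]; split; move=> [i _ <-]; exists i.
  - by move=> k _; exact: hausdorff_weight_ge0.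
  - by move=> ? ? _ _; exact: (@can_inj _ _ _ snd).
apply: lee_nneseries => k _; last by have [_ _] := PG k.
by move=> _; apply: nneseries_ge0 => m _ _; exact: (G_ge0 (k, m)).
Qed.

HB.instance Definition _ delta := isOuterMeasure.Build R 'rV[R]_n
  (hausdorff_pre s delta) (hausdorff_pre0 delta) (hausdorff_pre_ge0 delta)
  (@le_hausdorff_pre delta) (@hausdorff_pre_sigma_subadditive delta).

Lemma hausdorff_pre_le delta A : (0 < delta)%R ->
  hausdorff_pre s delta A <= hausdorff s A.
Proof. by move=> d0; apply: ereal_sup_ubound; exists delta. Qed.

Lemma hausdorff0 : hausdorff s (@set0 'rV[R]_n) = 0.
Proof.
apply/eqP; rewrite eq_le; apply/andP; split.
  by apply: ge_ereal_sup => _ [d _ <-]; rewrite hausdorff_pre0.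
by rewrite (le_trans _ (@hausdorff_pre_le 1%R _ _))// hausdorff_pre_ge0.
Qed.

Lemma hausdorff_ge0 A : 0 <= hausdorff s A.
Proof.
by rewrite (le_trans _ (@hausdorff_pre_le 1%R _ _))// hausdorff_pre_ge0.
Qed.

Lemma le_hausdorff : {homo @hausdorff R n s : A B / A `<=` B >-> A <= B}.
Proof.
move=> A B AB; apply: ge_ereal_sup => _ [d d0 <-].
by rewrite (le_trans (le_hausdorff_pre d AB))// hausdorff_pre_le.
Qed.

Lemma hausdorff_sigma_subadditive : sigma_subadditive (@hausdorff R n s).
Proof.
move=> A; apply: ge_ereal_sup => _ [d d0 <-].
rewrite (le_trans (hausdorff_pre_sigma_subadditive d A))//.
apply: lee_nneseries => k _; first by move=> _; exact: hausdorff_pre_ge0.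
exact: hausdorff_pre_le.
Qed.

HB.instance Definition _ := isOuterMeasure.Build R 'rV[R]_n
  (hausdorff s) hausdorff0 hausdorff_ge0 le_hausdorff
  hausdorff_sigma_subadditive.

Lemma hausdorff_metric A B (e : R) : (0 < e)%R ->
  (forall x y, A x -> B y -> (e <= enorm (x - y))%R) ->
  hausdorff s A + hausdorff s B <= hausdorff s (A `|` B).
Proof.
move=> e0 AB.
have H d : (0 < d)%R -> (d < e)%R -> hausdorff_pre s d A + hausdorff_pre s d B <=
    hausdorff s (A `|` B).
  move=> d0 de; rewrite (le_trans _ (hausdorff_pre_le _ d0))//.
  apply: le_ereal_inf_tmp => _ [U [ABU dU] <-].
  apply: (@le_trans _ _ (\sum_(k <oo) (hausdorff_weight s (U k `&` A) +
      hausdorff_weight s (U k `&` B)))).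
    rewrite nneseriesD; [|by move=> *; exact: hausdorff_weight_ge0..].
    apply: leeD; apply: ereal_inf_lbound.
      exists (fun k => U k `&` A) => //; split => [x Ax|k].
        by have [k _ Ukx] := ABU x (or_introl Ax); exists k.
      by rewrite (le_trans _ (dU k))// le_ediam.
    exists (fun k => U k `&` B) => //; split => [x Bx|k].
      by have [k _ Ukx] := ABU x (or_intror Bx); exists k.
    by rewrite (le_trans _ (dU k))// le_ediam.
  apply: lee_nneseries => k _.
    by move=> _; rewrite adde_ge0 ?hausdorff_weight_ge0.
  have [->|/set0P[x [Ux Ax]]] := eqVneq (U k `&` A) set0.
    by rewrite hausdorff_weight0 add0e le_hausdorff_weight.
  rewrite (_ : U k `&` B = set0) ?hausdorff_weight0 ?adde0 ?le_hausdorff_weight//.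
  rewrite -subset0 => y [Uy By].
  have := le_trans (enorm_le_ediam Ux Uy) (dU k); rewrite lee_fin leNgt.
  by rewrite (lt_le_trans de)// AB.
have [Aoo|Aoo] := eqVneq (hausdorff s A) +oo.
  rewrite (_ : hausdorff s (A `|` B) = +oo) ?leey//.
  by apply/eqP; rewrite -leye_eq -Aoo le_hausdorff//; exact: subsetUl.
rewrite addeC -leeBrDr; last by rewrite ge0_fin_numE ?hausdorff_ge0// ltey.
apply: ge_ereal_sup => _ [d1 /= d10 <-].
rewrite leeBrDr; last by rewrite ge0_fin_numE ?hausdorff_ge0// ltey.
have [Boo|Boo] := eqVneq (hausdorff_pre s d1 B) +oo.
  rewrite (_ : hausdorff s (A `|` B) = +oo) ?leey//.
  apply/eqP; rewrite -leye_eq -Boo (le_trans (hausdorff_pre_le _ d10))//.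
  by rewrite le_hausdorff//; exact: subsetUr.
rewrite addeC -leeBrDr; last by rewrite ge0_fin_numE ?hausdorff_pre_ge0// ltey.
apply: ge_ereal_sup => _ [d2 /= d20 <-].
rewrite leeBrDr; last by rewrite ge0_fin_numE ?hausdorff_pre_ge0// ltey.
pose d := (Num.min (Num.min d1 d2) (e / 2))%R.
have d0 : (0 < d)%R by rewrite !lt_min d10 d20 divr_gt0.
rewrite (le_trans _ (H d d0 _)) ?leeD ?hausdorff_pre_anti// /d ?ge_min ?lexx ?orbT//.
by rewrite gt_min; apply/orP; right; rewrite ltr_pdivrMr// ltr_pMr// ltr1n.
Qed.

Lemma open_caratheodory_hausdorff (O : set 'rV[R]_n) : open O ->
  (hausdorff s).-caratheodory O.
Proof.
move=> oO; apply: le_caratheodory_measurable => X /=.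
have [->|Xoo] := eqVneq (hausdorff s X) +oo; first by rewrite leey.
pose F k := [set x | X x /\ forall y, ~ O y -> (k.+1%:R^-1 <= enorm (x - y))%R].
have FXO k : F k `<=` X `&` O.
  move=> x [Xx xO]; split => //; apply: contrapT => /xO; rewrite subrr.
  rewrite /enorm /dotp big1 ?sqrtr0; last by move=> i _; rewrite mxE mul0r.
  by apply/negP; rewrite -ltNge invr_gt0 ltr0Sn.
have inv_le (a b : nat) : (a <= b)%N -> (b.+1%:R^-1 <= a.+1%:R^-1 :> R)%R.
  by move=> ab; rewrite lef_pV2 ?posrE ?ltr0Sn// ler_nat.
have inv_lt (a b : nat) : (a < b)%N -> (b.+1%:R^-1 < a.+1%:R^-1 :> R)%R.
  by move=> ab; rewrite ltf_pV2 ?posrE ?ltr0Sn// ltr_nat.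
have Fnd a b : (a <= b)%N -> F a `<=` F b.
  by move=> ab x [Xx xO]; split => // y /xO; apply: le_trans; exact: inv_le.
have XOF : X `&` O `<=` \bigcup_k F k.
  move=> x [Xx Ox]; move: oO; rewrite openE => /(_ _ Ox).
  rewrite /interior -nbhs_ballE => -[e /= e0 eO].
  exists (Num.truncn e^-1) => //; split => // y nOy; rewrite leNgt; apply/negP => xy.
  apply: nOy; apply: eO; rewrite -ball_normE/=.
  rewrite (le_lt_trans (mxnorm_le_enorm _))// (lt_le_trans xy)//.
  rewrite -[leRHS]invrK lef_pV2 ?posrE ?ltr0Sn ?invr_gt0//.
  by rewrite ltW// truncnS_gt.
pose B k := F k.+1 `\` F k.
have FBsep a b x y : F a x -> B b y ->
    (a.+1%:R^-1 - b.+1%:R^-1 <= enorm (x - y))%R.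
  move=> [Xx xO] [[Xy yO] nFy].
  have /existsNP[z /not_implyP[nOz /negP]] : ~ forall z, ~ O z ->
      (b.+1%:R^-1 <= enorm (y - z))%R by move=> H; exact: nFy.
  rewrite -ltNge => /ltW yz; rewrite lerBlDr (le_trans (xO _ nOz))//.
  by rewrite (le_trans (enorm_triangle y x z))// lerD2l.
have step2 i0 k : \sum_(0 <= i < k) hausdorff s (B (i.*2 + i0)%N) <= hausdorff s X.
  rewrite big_mkord.
  suff : \sum_(i < k) hausdorff s (B (i.*2 + i0)%N) <=
      hausdorff s (\big[setU/set0]_(i < k) B (i.*2 + i0)%N).
    move=> /le_trans; apply; apply: le_hausdorff => x.
    by rewrite -(bigcup_mkord k (fun i => B (i.*2 + i0)%N)) => -[i _ [[]]].
  elim: k => [|k ih]; first by rewrite !big_ord0 hausdorff0.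
  rewrite !big_ord_recr/= (le_trans (leeD2r _ ih))//.
  case: k {ih} => [|k].
    by rewrite !big_ord0 hausdorff0 add0e set0U.
  set j := (k.*2 + i0)%N.
  apply: (@hausdorff_metric _ _ (j.+2%:R^-1 - j.+3%:R^-1)%R).
    by rewrite subr_gt0 inv_lt.
  move=> x y; rewrite -(bigcup_mkord k.+1 (fun i => B (i.*2 + i0)%N)).
  move=> -[i /= ik [Fx _]] By.
  rewrite (_ : j.+3 = (k.+1.*2 + i0).+1); last by rewrite doubleS.
  apply: FBsep By; apply: Fnd Fx.
  by rewrite ltnS leq_add2r leq_double -ltnS.
have B_ge0 k : 0 <= hausdorff s (B k) by exact: hausdorff_ge0.
have partial k : \sum_(0 <= i < k.*2) hausdorff s (B i) <=
    hausdorff s X + hausdorff s X.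
  rewrite (_ : \sum_(0 <= i < k.*2) hausdorff s (B i) =
      \sum_(0 <= i < k) hausdorff s (B (i.*2 + 0)%N) +
      \sum_(0 <= i < k) hausdorff s (B (i.*2 + 1)%N)); first exact: leeD.
  rewrite -big_split/=; elim: k => [|k ih]; first by rewrite !big_geq.
  by rewrite doubleS !big_nat_recr//= ih addn0 addn1 addeA.
have Bsum : \sum_(0 <= i <oo) hausdorff s (B i) < +oo.
  apply: (@le_lt_trans _ _ (hausdorff s X + hausdorff s X)).
    apply: lime_le; first exact: is_cvg_nneseries.
    near=> k; apply: le_trans (partial k).
    by apply: lee_sum_nneg_natr => //; rewrite -addnn leq_addr.
  by rewrite lte_add_pinfty// ltey.
have tail0 := nneseries_tail_cvg Bsum (fun k _ => B_ge0 k).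
have main k : hausdorff s (X `&` O) + hausdorff s (X `&` ~` O) <=
    hausdorff s X + \sum_(k <= i <oo) hausdorff s (B i).
  have XOU : X `&` O `<=` F k `|` \bigcup_(i in ~` `I_k) B i.
    move=> x /XOF[j _ Fj]; have [Fk|nFk] := pselect (F k x); [by left|right].
    have kj : (k <= j)%N.
      by rewrite leqNgt; apply/negP => jk; apply: nFk; apply: Fnd Fj; exact: ltnW.
    move: Fj; rewrite -(subnKC kj); elim: (j - k)%N => [|l ih].
      by rewrite addn0.
    rewrite addnS => Fl; have [/ih//|nFl] := pselect (F (k + l)%N x).
    by exists (k + l)%N => //=; apply/negP; rewrite -leqNgt leq_addr.
  have XOle : hausdorff s (X `&` O) <=
      hausdorff s (F k) + \sum_(k <= i <oo) hausdorff s (B i).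
    rewrite (le_trans (le_hausdorff XOU))// (le_trans (outer_measureU2 _ _ _))//.
    by rewrite leeD2l// outer_measure_sigma_subadditive_tail.
  rewrite (le_trans (leeD2r _ XOle))// addeAC leeD2r//.
  apply: (@le_trans _ _ (hausdorff s (F k `|` (X `&` ~` O)))).
    apply: (@hausdorff_metric _ _ k.+1%:R^-1); first by rewrite invr_gt0 ltr0Sn.
    by move=> x y [_ xO] [_ nOy]; exact: xO.
  by apply: le_hausdorff => x [/FXO[]|[]].
rewrite -[leRHS]adde0.
have : hausdorff s X + \sum_(k <= i <oo) hausdorff s (B i) @[k --> \oo] -->
    hausdorff s X + 0.
  apply: cvgeD => //; last exact: cvg_cst.
  by rewrite fin_num_adde_defl.
move=> cvgX; rewrite -(cvg_lim _ cvgX)//; apply: lime_ge.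
  by apply/cvg_ex; eexists; exact: cvgX.
by apply: nearW => k; exact: main.
Unshelve. all: by end_near. Qed.

Lemma measurable_caratheodory_hausdorff (A : set 'rV[R]_n) : measurable A ->
  (hausdorff s).-caratheodory A.
Proof.
apply: smallest_sub; last exact: open_caratheodory_hausdorff.
split => [|B mB|F mF].
- exact: caratheodory_measurable_set0.
- by rewrite setTD; exact: caratheodory_measurable_setC.
- exact: caratheodory_measurable_bigcup.
Qed.

Lemma hausdorff_semi_sigma_additive : semi_sigma_additive (@hausdorff R n s).
Proof.
move=> F mF tF mUF; apply: (@caratheodory_measure_sigma_additive R _ (hausdorff s)).
- by move=> i; exact: measurable_caratheodory_hausdorff.
- exact: tF.
- exact: measurable_caratheodory_hausdorff.
Qed.

HB.instance Definition _ := isMeasure.Build _ 'rV[R]_n R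
  (hausdorff s) hausdorff0 hausdorff_ge0 hausdorff_semi_sigma_additive.

End hausdorff_theory.
Section sphere_theory.
Context {R : realType}.

Lemma continuous_measurable_fun_rV (n : nat) (f : 'rV[R]_n -> R) :
  continuous f -> measurable_fun setT f.
Proof.
move=> /continuousP cf; apply: (measurability _ (RGenOpens.measurableE R)).
move=> /= _ [_ [a [b ->] <-]]; rewrite setTI; apply: sub_sigma_algebra.
by apply: cf; exact: interval_open.
Qed.

Lemma measurable_fun_dotp (n : nat) (f g : 'rV[R]_n -> 'rV[R]_n) :
  (forall i, measurable_fun setT (fun x => f x 0 i)) ->
  (forall i, measurable_fun setT (fun x => g x 0 i)) ->
  measurable_fun setT (fun x => dotp (f x) (g x)).
Proof.
by move=> mf mg; apply: measurable_sum => i; exact: measurable_funM.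
Qed.

Lemma measurable_coord (n : nat) (i : 'I_n) :
  measurable_fun setT (fun x : 'rV[R]_n => x 0 i).
Proof. by apply: continuous_measurable_fun_rV; exact: coord_continuous. Qed.

Lemma sphereP (n : nat) (x : 'rV[R]_n) : sphere R n x <-> dotp x x = 1.
Proof.
rewrite -enorm_sqr; split => [->|x1]; first by rewrite expr1n.
by apply/eqP; rewrite -(@eqrXn2 _ 2) ?enorm_ge0// expr1n x1.
Qed.

Lemma measurable_sphere (n : nat) : measurable (sphere R n).
Proof.
rewrite (_ : sphere R n = setT `&` (fun x => dotp x x) @^-1` [set 1]).
  have := @measurable_fun_dotp n id id (@measurable_coord n) (@measurable_coord n).
  by move=> mf; apply: mf.
by rewrite setTI; apply/seteqP; split => x /sphereP.
Qed.

Let grid (m : nat) (t : R) (k : nat) : Prop :=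
  - 1 + 2 * k%:R / m%:R <= t <= - 1 + 2 * k.+1%:R / m%:R.

Let grid_exists (m : nat) (t : R) : (0 < m)%N -> -1 <= t <= 1 ->
  exists k : 'I_m, grid m t k.
Proof.
move=> m0 /andP[t1 t2]; have mR : 0 < m%:R :> R by rewrite ltr0n.
suff : exists2 k, (k < m)%N & grid m t k.
  by move=> [k km gk]; exists (Ordinal km).
suff H j : (j < m)%N -> t <= - 1 + 2 * j.+1%:R / m%:R ->
    exists2 k, (k < m)%N & grid m t k.
  apply: (H m.-1); rewrite ?prednK// mulfK ?gt_eqF//; lra.
elim: j => [|j ih] jm tj.
  by exists 0%N => //; rewrite /grid mulr0 mul0r addr0 t1 tj.
have [tj'|/ltW tj'] := leP t (- 1 + 2 * j.+1%:R / m%:R).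
  by apply: ih => //; exact: ltnW.
by exists j.+1 => //; rewrite /grid tj' tj.
Qed.

Let cell (p m : nat) (c : 'I_p.+1 * bool * {ffun 'I_p -> 'I_m}) :=
  [set x : 'rV[R]_p.+1 | [/\ sphere R p.+1 x, 0 < (-1) ^+ c.1.2 * x 0 c.1.1 &
     forall j, grid m (x 0 (lift c.1.1 j) / x 0 c.1.1) (c.2 j)]].

Let cell_cover (p m : nat) : (0 < m)%N ->
  sphere R p.+1 `<=` \bigcup_(c in setT) @cell p m c.
Proof.
move=> m0 x Sx.
pose i : 'I_p.+1 := [arg max_(j > ord0) `|x 0 j|]%O.
have xi j : `|x 0 j| <= `|x 0 i| by rewrite /i; case: arg_maxP => // k _; exact.
have xi0 : x 0 i != 0.
  apply/eqP => xi0; move/sphereP : Sx; rewrite /dotp big1 => [/eqP|j _].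
    by rewrite eq_sym oner_eq0.
  apply/eqP; rewrite mulf_eq0 orbb -normr_le0.
  by rewrite (le_trans (xi j))// xi0 normr0.
have /choice[f Hf] : forall j, exists k : 'I_m, grid m (x 0 (lift i j) / x 0 i) k.
  move=> j; apply: grid_exists => //; rewrite -ler_norml normrM normfV.
  by rewrite ler_pdivrMr ?normr_gt0// mul1r.
exists (i, x 0 i < 0, [ffun j => f j]) => //; split => //=.
  by rewrite -normrEsign normr_gt0.
by move=> j; rewrite ffunE.
Qed.

Let cell_ediam (p m : nat) (c : 'I_p.+1 * bool * {ffun 'I_p -> 'I_m}) :
  (0 < m)%N -> (ediam (cell c) <= (2 * p.+1%:R / m%:R)%:E)%E.
Proof.
move=> m0; have mR : 0 < m%:R :> R by rewrite ltr0n.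
case: c => -[i b] f; apply: ge_ereal_sup => _ [x [Sx xi fx] [y [Sy yi fy] <-]].
rewrite /= in xi fx yi fy; rewrite lee_fin.
have B0 : 0 <= 2 * p.+1%:R / m%:R :> R by rewrite divr_ge0 ?mulr_ge0.
rewrite -(@ler_pXn2r _ 2)// ?nnegrE ?enorm_ge0// enorm_sqr.
set a := x 0 i; set a' := y 0 i.
have aa'0 : 0 < a * a' by have := mulr_gt0 xi yi; rewrite mulrACA -expr2 sqrr_sign mul1r.
have a0 : a != 0 by apply: contraTneq aa'0 => ->; rewrite mul0r ltxx.
have a'0 : a' != 0 by apply: contraTneq aa'0 => ->; rewrite mulr0 ltxx.
have le1 (z : 'rV[R]_p.+1) : sphere R p.+1 z -> `|z 0 i| <= 1.
  move=> /sphereP z1; rewrite -(@ler_pXn2r _ 2)// ?nnegrE// expr1n real_normK//.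
    by rewrite -z1 /dotp (bigD1 i)//= -expr2 lerDl sumr_ge0// => j _; rewrite -expr2 sqr_ge0.
  exact: num_real.
have aa'1 : a * a' <= 1.
  rewrite (le_trans (ler_norm _))// normrM -[leRHS]mulr1.
  by rewrite ler_pM// le1.
move/sphereP : (Sx) => x1; move/sphereP : (Sy) => y1.
(* the radial projection onto the sphere is 1-Lipschitz outside the unit ball *)
have proj : dotp (x - y) (x - y) <= dotp (a^-1 *: x - a'^-1 *: y) (a^-1 *: x - a'^-1 *: y).
  have E (u v : R) : dotp (u *: x - v *: y) (u *: x - v *: y) =
      u ^+ 2 + v ^+ 2 - 2 * (u * v) * dotp x y.
    rewrite -(scaleNr v y) dotpDl !dotpZl !(dotpC _ (_ + _)) !dotpDl !dotpZl.
    rewrite (dotpC y x) x1 y1.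
    by ring.
  have := E 1 1; rewrite !scale1r => Exy; have := dotp_ge0 (x - y).
  rewrite Exy E => c1; set w := dotp x y in c1 *.
  have uv1 : 1 <= a^-1 * a'^-1 by rewrite -invfM invf_ge1// mulrC.
  set u := a^-1 in uv1 *; set v := a'^-1 in uv1 *.
  have := sqr_ge0 (u - v).
  have : 0 <= (u * v - 1) * (1 - w) by apply: mulr_ge0; lra.
  by nra.
rewrite (le_trans proj)// /dotp (bigD1_ord i)//= !mxE !mulVf// subrr mulr0 add0r.
apply: (@le_trans _ _ (\sum_(j < p) (2 / m%:R) ^+ 2)).
  apply: ler_sum => j _; rewrite !mxE -expr2 -real_normK ?num_real//.
  rewrite ler_pXn2r ?nnegrE ?divr_ge0//.
  have := fx j; have := fy j; rewrite /grid -/a -/a'.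
  have -> : 2 * (f j).+1%:R / m%:R = 2 * (f j)%:R / m%:R + 2 / m%:R :> R.
    by rewrite -[(f j).+1%:R]natr1 mulrDr mulr1 mulrDl.
  move=> /andP[y2 y3] /andP[x2 x3].
  rewrite ler_norml (mulrC a^-1) (mulrC a'^-1).
  by apply/andP; split; lra.
rewrite sumr_const card_ord -[leLHS]mulr_natr (mulrAC 2) [leRHS]exprMn.
by rewrite ler_wpM2l ?sqr_ge0// -natrX ler_nat (@leq_trans p.+1)// leq_pmulr.
Qed.

Lemma hausdorff_sphere_fin (n : nat) :
  (hausdorff n.-1 (sphere R n) < +oo)%E.
Proof.
case: n => [|p].
  rewrite (_ : sphere R 0 = set0) ?measure0 ?ltry//.
  rewrite -subset0 => x /sphereP; rewrite /dotp big_ord0 => /eqP.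
  by rewrite eq_sym oner_eq0.
pose K : R := hausdorff_cst p * (2 * p.+1%:R) ^+ p.
pose M : R := #|{: 'I_p.+1 * bool}|%:R * K.
have K0 : 0 <= K by rewrite mulr_ge0 ?hausdorff_cst_ge0 ?exprn_ge0 ?mulr_ge0.
apply: (@le_lt_trans _ _ M%:E); last exact: ltry.
apply: ge_ereal_sup => _ [d /= d0 <-].
pose m := (Num.truncn (2 * p.+1%:R / d)).+1.
have mR : 0 < m%:R :> R by rewrite ltr0n.
have md : 2 * p.+1%:R / m%:R <= d.
  rewrite ler_pdivrMr// (mulrC d) -ler_pdivrMr//.
  by rewrite ltW// /m truncnS_gt.
pose J := ('I_p.+1 * bool * {ffun 'I_p -> 'I_m})%type.
apply: (@le_trans _ _ (hausdorff_pre p d (\big[setU/set0]_(c : J) cell c))).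
  apply: le_hausdorff_pre => x /(@cell_cover p m isT)[c _ cx].
  by rewrite (bigD1 c)//=; left.
apply: (@le_trans _ _ (\sum_(c : J) (K / m%:R ^+ p)%:E)%E).
  apply: (@big_ind2 _ _ (fun A b => (hausdorff_pre p d A <= b)%E)).
  - by rewrite hausdorff_pre0.
  - by move=> A a B b Aa Bb; rewrite (le_trans (outer_measureU2 _ _ _))// leeD.
  move=> c _; have dc := cell_ediam c isT.
  rewrite (le_trans (hausdorff_pre_le_weight _ _))//.
    by rewrite (le_trans dc).
  rewrite /hausdorff_weight; case: ifPn => [_|/set0P c0].
    by rewrite lee_fin divr_ge0// exprn_ge0.
  have -> : K / m%:R ^+ p = hausdorff_cst p * (2 * p.+1%:R / m%:R) ^+ p.
    by rewrite [in RHS]expr_div_n mulrA.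
  rewrite [leRHS]EFinM lee_wpmul2l ?lee_fin ?hausdorff_cst_ge0//.
  have := ediam_ge0 c0; move: (ediam _) dc => e + e0.
  case: e e0 => [e||]// e0 dc; rewrite -EFin_expe lee_fin.
  by rewrite lerXn2r ?nnegrE// -?lee_fin// (le_trans e0).
rewrite sumEFin lee_fin sumr_const -[leLHS]mulr_natl.
have -> : #|{: J}| = (#|{: 'I_p.+1 * bool}| * m ^ p)%N.
  by rewrite [LHS]card_prod card_ffun !card_ord.
rewrite natrM natrX -mulrA ler_wpM2l//.
by rewrite mulrC mulfVK// expf_neq0// gt_eqF.
Qed.

End sphere_theory.

(* A measure on the whole of 'rV_n, carried by the sphere. *)
Definition surface_measure (R : realType) (n : nat) :
  set 'rV[R]_n -> \bar R := mrestr (hausdorff n.-1) (@measurable_sphere R n).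
Arguments surface_measure : clear implicits.

Section surface_measure.
Context {R : realType} (n : nat).

HB.instance Definition _ := Measure.on (surface_measure R n).

Let surface_measure_fin : fin_num_fun (surface_measure R n).
Proof.
apply: lty_fin_num_fun.
rewrite [ltLHS](_ : _ = hausdorff n.-1 (sphere R n)).
  exact: hausdorff_sphere_fin.
by rewrite -[sphere R n in RHS]setTI.
Qed.

HB.instance Definition _ := Measure_isFinite.Build _ _ _
  (surface_measure R n) surface_measure_fin.

End surface_measure.

Section fvml.
Context {R : realType}.

Definition besselI (nu x : R) : R :=
  limn (series (fun m : nat =>
    (x / 2) `^ (nu + 2 * m%:R) / (m`!%:R * Gamma (nu + m%:R + 1)))).

Definition fvml_cst (n : nat) (kappa : R) : R :=
  kappa `^ (n%:R / 2 - 1) /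
    ((2 * pi) `^ (n%:R / 2) * besselI (n%:R / 2 - 1) kappa).

Definition fvml_pdf (n : nat) (mu : 'rV[R]_n) (kappa : R) (x : 'rV[R]_n) : R :=
  fvml_cst n kappa * expR (kappa * dotp mu x).

Definition fvml (n : nat) (mu : 'rV[R]_n) (kappa : R) :
    set 'rV[R]_n -> \bar R :=
  fun A => (\int[surface_measure R n]_(x in A) (fvml_pdf mu kappa x)%:E)%E.

Lemma besselI_ge0 (nu x : R) : 0 <= besselI nu x.
Proof.
rewrite /besselI; set u := series _.
have [cu|ncu] := pselect (cvgn u); last by rewrite dvgP.
apply: limr_ge => //; apply: nearW => k; apply: sumr_ge0 => m _.
by rewrite divr_ge0 ?powR_ge0// mulr_ge0 ?Gamma_ge0.
Qed.

Lemma fvml_cst_ge0 (n : nat) (kappa : R) : 0 <= fvml_cst n kappa.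
Proof. by rewrite divr_ge0 ?mulr_ge0 ?powR_ge0 ?besselI_ge0. Qed.

Section fvml_measure.
Variables (n : nat) (mu : 'rV[R]_n) (kappa : R).
Local Open Scope ereal_scope.

Lemma fvml_pdf_ge0 x : (0 <= fvml_pdf mu kappa x)%R.
Proof. by rewrite mulr_ge0 ?fvml_cst_ge0 ?expR_ge0. Qed.

Lemma measurable_fvml_pdf : measurable_fun setT (fvml_pdf mu kappa).
Proof.
apply: measurable_funM => //; apply: measurableT_comp => //.
apply: measurable_funM => //; apply: measurable_fun_dotp => i //.
exact: measurable_coord.
Qed.

Let fvml0 : fvml mu kappa set0 = 0.
Proof. by rewrite /fvml integral_set0. Qed.

Let fvml_ge0 A : 0 <= fvml mu kappa A.
Proof. by apply: integral_ge0 => x _; rewrite lee_fin fvml_pdf_ge0. Qed.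

Let fvml_sigma_additive : semi_sigma_additive (fvml mu kappa).
Proof.
move=> F mF tF mUF; rewrite /fvml; apply: cvg_toP.
  apply: ereal_nondecreasing_is_cvgn => a b ab.
  apply: lee_sum_nneg_natr => // k _ _; apply: integral_ge0 => x _.
  by rewrite lee_fin fvml_pdf_ge0.
rewrite ge0_integral_bigcup//=.
- apply/measurable_funTS/measurableT_comp => //.
  exact: measurable_fvml_pdf.
- by move=> x _; rewrite lee_fin fvml_pdf_ge0.
Qed.

HB.instance Definition _ := isMeasure.Build _ _ _ (fvml mu kappa)
  fvml0 fvml_ge0 fvml_sigma_additive.

Let fvml_fin : fin_num_fun (fvml mu kappa).
Proof.
suff : fvml mu kappa setT < +oo by exact: lty_fin_num_fun.
rewrite /fvml; pose K := (fvml_cst n kappa * expR (`|kappa| * enorm mu))%R.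
apply: (@le_lt_trans _ _ (K%:E * surface_measure R n setT)); last first.
  apply: lte_mul_pinfty => //.
    by rewrite lee_fin mulr_ge0 ?fvml_cst_ge0 ?expR_ge0.
  by rewrite -ge0_fin_numE ?fin_num_measure.
rewrite (eq_integral (fun x => `|(fvml_pdf mu kappa x)%:E|)); last first.
  by move=> x _; rewrite gee0_abs// lee_fin fvml_pdf_ge0.
apply: integral_le_bound => //.
- by apply/measurable_EFinP; exact: measurable_fvml_pdf.
- by rewrite lee_fin mulr_ge0 ?fvml_cst_ge0 ?expR_ge0.
exists (~` sphere R n); split.
- by apply: measurableC; exact: measurable_sphere.
- rewrite [LHS](_ : _ = hausdorff n.-1 (~` sphere R n `&` sphere R n))//.
  by rewrite setICl measure0.
move=> x /= + Sx; apply => _; rewrite lee_fin ger0_norm ?fvml_pdf_ge0//.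
rewrite ler_wpM2l ?fvml_cst_ge0// ler_expR (le_trans (ler_norm _))// normrM.
have := dotp_le mu x; rewrite Sx mulr1 => h1.
rewrite ler_wpM2l// ler_norml h1 andbT.
have := dotp_le (- mu) x; rewrite Sx enormN mulr1 -scaleN1r dotpZl mulN1r.
by rewrite lerNl.
Qed.

HB.instance Definition _ := Measure_isFinite.Build _ _ _ (fvml mu kappa)
  fvml_fin.

End fvml_measure.
End fvml.

Section iid_law.
Local Open Scope ereal_scope.
Context d (T : measurableType d) (R : realType).

Section cons_law.
Variables (N : nat) (P : {finite_measure set T -> \bar R}).
Variable Q : {finite_measure set (N.-tuple T) -> \bar R}.

Definition cons_tuple (p : T * N.-tuple T) : N.+1.-tuple T := [tuple of p.1 :: p.2].

Definition cons_law : set (N.+1.-tuple T) -> \bar R :=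
  pushforward (P \x Q) cons_tuple.

Lemma measurable_cons_tuple : measurable_fun setT cons_tuple.
Proof. exact: measurable_cons. Qed.

Let cons_law0 : cons_law set0 = 0.
Proof. by rewrite /cons_law /pushforward preimage_set0 measure0. Qed.

Let cons_law_ge0 A : 0 <= cons_law A.
Proof. by rewrite /cons_law /pushforward measure_ge0. Qed.

Let cons_law_sigma_additive : semi_sigma_additive cons_law.
Proof.
have mC A : measurable A -> measurable (cons_tuple @^-1` A).
  by move=> mA; rewrite -[X in measurable X]setTI; exact: measurable_cons_tuple.
move=> F mF tF mUF; rewrite /cons_law /pushforward preimage_bigcup.
apply: measure_semi_sigma_additive.
- by move=> k; exact: mC.
- apply/trivIsetP => /= i j _ _ ij; rewrite -preimage_setI.
  by move/trivIsetP : tF => /(_ _ _ _ _ ij) ->//; rewrite preimage_set0.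
- by rewrite -preimage_bigcup; exact: mC.
Qed.

HB.instance Definition _ := isMeasure.Build _ _ _ cons_law
  cons_law0 cons_law_ge0 cons_law_sigma_additive.

Let cons_law_fin : fin_num_fun cons_law.
Proof.
suff : (P \x Q) (setT `*` setT) < +oo.
  by rewrite setXTT => ?; exact: lty_fin_num_fun.
rewrite product_measure1E//; apply: lte_mul_pinfty => //.
  by rewrite fin_num_measure.
by rewrite -ge0_fin_numE ?fin_num_measure.
Qed.

HB.instance Definition _ := Measure_isFinite.Build _ _ _ cons_law cons_law_fin.

End cons_law.

(* The N-fold product of P, characterized by [iid_law_rectangle] below. *)
Fixpoint iid_law (P : {finite_measure set T -> \bar R}) (N : nat) :
    {finite_measure set (N.-tuple T) -> \bar R} :=
  if N is N'.+1 then cons_law P (iid_law P N') else \d_([tuple] : 0.-tuple T).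

Lemma iid_law_rectangle (P : {finite_measure set T -> \bar R}) (N : nat)
    (A : 'I_N -> set T) : (forall i, measurable (A i)) ->
  iid_law P N [set x | forall i, A i (tnth x i)] = \prod_(i < N) P (A i).
Proof.
elim: N A => [|N ih] A mA.
  rewrite big_ord0 /= diracE mem_set//.
  by move=> [].
pose B := [set y : N.-tuple T | forall i, A (lift ord0 i) (tnth y i)].
have mB : measurable B.
  have -> : B = \bigcap_(i in [set: 'I_N]) (@tnth N T ^~ i @^-1` A (lift ord0 i)).
    by apply/seteqP; split => y By i; [move=> _|]; exact: By.
  apply: fin_bigcap_measurable => // i _; rewrite -[X in measurable X]setTI.
  exact: measurable_tnth.
rewrite big_ord_recl -(ih (fun i => A (lift ord0 i)))// -product_measure1E//.
transitivity ((P \x iid_law P N)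
  (@cons_tuple N @^-1` [set x | forall i, A i (tnth x i)])) => //.
congr (product_measure1 P (iid_law P N) _); apply/seteqP.
split=> -[x y] /=.
  move=> H; split; first by have := H ord0; rewrite tnth0.
  by move=> i; have := H (lift ord0 i); rewrite tnthS.
move=> [Ax By] i; have [j ->|->] := unliftP ord0 i; last by rewrite tnth0.
by rewrite tnthS; exact: By.
Qed.

End iid_law.

(* The library's measurable structure on tuples is the product one; since 'rV_n is
   second countable it is the Borel one of the product space. *)
Definition sphere_tuple (R : realType) (n N : nat) : set (N.-tuple 'rV[R]_n) :=
  [set x | forall i, sphere R n (tnth x i)].

Arguments sphere_tuple : clear implicits.

Lemma measurable_sphere_tuple (R : realType) (n N : nat) :
  measurable (sphere_tuple R n N).
Proof.
have -> : sphere_tuple R n N =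
    \bigcap_(i in [set: 'I_N]) (@tnth N 'rV[R]_n ^~ i @^-1` sphere R n).
  by apply/seteqP; split => x Sx i; [move=> _|]; exact: Sx.
apply: fin_bigcap_measurable => // i _; rewrite -[X in measurable X]setTI.
by apply: measurable_tnth => //; exact: measurable_sphere.
Qed.

Definition real_analytic_on (R : realType) (U : set R) (h : R -> R) : Prop :=
  forall x, U x -> exists2 r, 0 < r & exists a : nat -> R,
    forall y, `|y - x| < r ->
      series (fun k => a k * (y - x) ^+ k) @ \oo --> h y.

(* Main.v *)
Require Import Defs.
From mathcomp Require Import all_boot all_order all_algebra.
From mathcomp Require Import all_classical all_reals all_analysis.
From mathcomp Require Import measurable_realfun.
From mathcomp Require Import ring lra.
Import Order.TTheory GRing.Theory Num.Theory.
Import numFieldNormedType.Exports.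
Local Open Scope classical_set_scope.
Local Open Scope ring_scope.
Set Implicit Arguments.
Unset Strict Implicit.
Unset Printing Implicit Defensive.

(** With Z = mu . (x_1 + ... + x_N), the hypothesis says that
    g(kappa) / C_n(kappa)^N is the integral of theta e^(kappa Z) against the
    N-fold product of the surface measure, for every unit vector mu. Averaging
    over mu and -mu replaces e^(kappa Z) by cosh(kappa Z); since |Z| <= N, the
    cosh series can be integrated term by term, which gives an entire function
    of kappa^2. The Bessel series gives 1 / C_n(kappa) = B(kappa^2) / K with B
    entire and positive on [0, oo), so that g(kappa) = K^N Phi(kappa^2) /
    B(kappa^2)^N with Phi and B entire. In particular it is never needed that
    C_n(kappa) normalizes the density. *)

(** * Power series *)

Section power_series.
Context {R : realType}.
Implicit Types (f g : R -> R) (a b u v : nat -> R) (x y r s t d M : R).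

Lemma cvg_series_geometric_bound u M t : 0 <= t -> t < 1 ->
  (forall k, `|u k| <= M * t ^+ k) -> cvgn (series u).
Proof.
move=> t0 t1 uM; apply: normed_cvg; apply: (series_le_cvg _ _ uM).
- by move=> k; exact: normr_ge0.
- by move=> k; exact: le_trans (uM k).
- by apply: is_cvg_geometric_series; rewrite ger0_norm.
Qed.

Definition cauchy_prod u v (k : nat) := \sum_(i < k.+1) u i * v (k - i)%N.

Lemma cauchy_prod_bound u v M M' t k : 0 <= t ->
  (forall k, `|u k| <= M * t ^+ k) -> (forall k, `|v k| <= M' * t ^+ k) ->
  `|cauchy_prod u v k| <= k.+1%:R * (M * M' * t ^+ k).
Proof.
move=> t0 uM vM; rewrite (le_trans (ler_norm_sum _ _ _))//.
rewrite mulr_natl -[X in _ *+ X](card_ord k.+1) -sumr_const.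
apply: ler_sum => i _; rewrite normrM.
have -> : t ^+ k = t ^+ i * t ^+ (k - i) by rewrite -exprD subnKC// leq_ord.
by rewrite mulrACA ler_pM.
Qed.

Lemma natr_le_expn k : k.+1%:R <= 2 ^+ k :> R.
Proof. by rewrite -natrX ler_nat ltn_expl. Qed.

(* The polynomial product of the two truncations agrees with the Cauchy product
   below degree n; the ratio 1/8 absorbs both the factor k + 1 in the bound on
   the other coefficients and their number n. *)
Lemma cvg_series_cauchy_prod u v M M' (U V : R) :
  (forall k, `|u k| <= M * 8^-1 ^+ k) -> (forall k, `|v k| <= M' * 8^-1 ^+ k) ->
  series u @ \oo --> U -> series v @ \oo --> V ->
  series (cauchy_prod u v) @ \oo --> U * V.
Proof.
move=> uM vM cu cv.
have M0 : 0 <= M by have := le_trans (normr_ge0 _) (uM 0%N); rewrite mulr1.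
have M'0 : 0 <= M' by have := le_trans (normr_ge0 _) (vM 0%N); rewrite mulr1.
pose D n := series u n * series v n - series (cauchy_prod u v) n.
suff D0 : D @ \oo --> (0 : R).
  have -> : series (cauchy_prod u v) = (fun n => series u n * series v n - D n).
    by apply/funext => n; rewrite /D opprB addrC subrK.
  by rewrite -[U * V]subr0; apply: cvgB => //; exact: cvgM.
have DE n : `|D n| <= M * M' * 2^-1 ^+ n.
  pose p := \poly_(i < n) u i; pose q := \poly_(i < n) v i.
  have pE : series u n = p.[1].
    rewrite /series/= big_mkord horner_poly.
    by apply: eq_bigr => i _; rewrite expr1n mulr1.
  have qE : series v n = q.[1].
    rewrite /series/= big_mkord horner_poly.
    by apply: eq_bigr => i _; rewrite expr1n mulr1.
  have spq : (size (p * q)%R <= n + n)%N.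
    rewrite (leq_trans (size_polyMleq _ _))// (leq_trans (leq_pred _))//.
    by rewrite leq_add// size_poly.
  have pqE k : (k < n)%N -> (p * q)`_k = cauchy_prod u v k.
    move=> kn; rewrite coefM; apply: eq_bigr => i _; rewrite !coef_poly.
    by rewrite (leq_ltn_trans (leq_ord i) kn) (leq_ltn_trans (leq_subr _ _) kn).
  have pqM k : `|(p * q)`_k| <= k.+1%:R * (M * M' * 8^-1 ^+ k).
    rewrite coefM -[X in `|X|]/(cauchy_prod (fun i => p`_i) (fun i => q`_i) k).
    apply: cauchy_prod_bound => // j; rewrite coef_poly; case: ifP => // _;
      by rewrite normr0 mulr_ge0// exprn_ge0.
  have -> : D n = \sum_(n <= k < n + n) (p * q)`_k.
    rewrite /D pE qE -hornerM (horner_coef_wide _ spq).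
    rewrite -(big_mkord xpredT (fun k => (p * q)`_k * 1 ^+ k)).
    rewrite (big_cat_nat (n := n)) ?leq_addr//= /series/=.
    rewrite addrAC [X in X - _](eq_big_nat _ _ (F2 := cauchy_prod u v)).
      rewrite subrr add0r; apply: eq_bigr => k _; by rewrite expr1n mulr1.
    by move=> k /andP[_ kn]; rewrite expr1n mulr1 pqE.
  rewrite (le_trans (ler_norm_sum _ _ _))//.
  apply: (@le_trans _ _ (\sum_(n <= k < n + n) M * M' * 4^-1 ^+ n)).
    apply: ler_sum_nat => k /andP[nk _]; rewrite (le_trans (pqM k))//.
    rewrite mulrCA ler_wpM2l ?mulr_ge0//.
    apply: (@le_trans _ _ (4^-1 ^+ k)).
      have -> : 4^-1 = 2 * 8^-1 :> R by lra.
      by rewrite exprMn ler_wpM2r ?exprn_ge0// natr_le_expn.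
    by rewrite ler_wiXn2l//; lra.
  rewrite sumr_const_nat addnK -[leLHS]mulr_natl mulrCA ler_wpM2l ?mulr_ge0//.
  have -> : 2^-1 = 2 * 4^-1 :> R by lra.
  rewrite exprMn ler_wpM2r ?exprn_ge0// (le_trans _ (natr_le_expn n))//.
  by rewrite ler_nat.
apply/norm_cvg0P; apply: (squeeze_cvgr (f := fun=> 0) (h := geometric (M * M') 2^-1)).
- by apply: nearW => n; rewrite normr_ge0 DE.
- exact: cvg_cst.
- by apply: cvg_geometric; rewrite ger0_norm; lra.
Qed.

(* The radius is only required to be small enough for the geometric bound on
   the coefficients, which is what products and inverses are estimated with. *)
Definition psum_at f x r a :=
  (exists M, forall k, `|a k| * r ^+ k <= M) /\
  forall y, `|y - x| < r -> series (fun k => a k * (y - x) ^+ k) @ \oo --> f y.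

Definition analytic_at f x := exists2 r, 0 < r & exists a, psum_at f x r a.

Lemma psum_at_le f x r s a : 0 < s -> s <= r -> psum_at f x r a -> psum_at f x s a.
Proof.
move=> s0 sr [[M aM] fa]; split; last by move=> y ys; apply: fa; exact: lt_le_trans sr.
exists M => k; rewrite (le_trans _ (aM k))// ler_wpM2l// lerXn2r ?nnegrE//.
  exact: ltW.
by rewrite (le_trans _ sr)// ltW.
Qed.

(** A bound on the terms at radius [r] gains a factor [t ^+ k] at distance [t * r]. This feeds
    products with ratio 1/8 and convergence with ratio [|y - x| / s]. *)
Lemma coef_geometric_bound a r d M t : 0 < r -> `|d| <= t * r ->
  (forall k, `|a k| * r ^+ k <= M) -> forall k, `|a k * d ^+ k| <= M * t ^+ k.
Proof.
move=> r0 dt aM k.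
have t0 : 0 <= t by rewrite -(@pmulr_lge0 _ r)// (le_trans _ dt).
rewrite normrM normrX (@le_trans _ _ (`|a k| * (t * r) ^+ k))//.
  by rewrite ler_wpM2l// lerXn2r ?nnegrE// mulr_ge0// ltW.
by rewrite exprMn mulrCA mulrC ler_wpM2r// exprn_ge0.
Qed.

Lemma cauchy_prod_expr a b d k :
  cauchy_prod a b k * d ^+ k = cauchy_prod (fun k => a k * d ^+ k) (fun k => b k * d ^+ k) k.
Proof.
rewrite /cauchy_prod mulr_suml; apply: eq_bigr => i _.
have -> : d ^+ k = d ^+ i * d ^+ (k - i) by rewrite -exprD subnKC// leq_ord.
by rewrite mulrACA.
Qed.

(** Shrinking the disc to radius [r / 8] gives the terms of both series the ratio 1/8 that
    [cvg_series_cauchy_prod] asks for. *)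
Lemma psum_at_cvgM f g x r a b y : 0 < r -> psum_at f x r a -> psum_at g x r b ->
  `|y - x| < r / 8 ->
  series (fun k => cauchy_prod a b k * (y - x) ^+ k) @ \oo --> f y * g y.
Proof.
move=> r0 [[M aM] fa] [[M' bM] gb] yr.
have yr' : `|y - x| < r by lra.
under eq_fun do rewrite cauchy_prod_expr.
have yr8 : `|y - x| <= 8^-1 * r by lra.
apply: (cvg_series_cauchy_prod _ _ (fa _ yr') (gb _ yr')).
  exact: (coef_geometric_bound r0 yr8 aM).
exact: (coef_geometric_bound r0 yr8 bM).
Qed.

Lemma analytic_atM f g x : analytic_at f x -> analytic_at g x ->
  analytic_at (fun y => f y * g y) x.
Proof.
move=> [r r0 [a fa]] [s s0 [b gb]]; pose e := Num.min r s.
have e0 : 0 < e by rewrite lt_min r0.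
have {}fa : psum_at f x e a by apply: psum_at_le fa => //; rewrite ge_min lexx.
have {}gb : psum_at g x e b by apply: psum_at_le gb => //; rewrite ge_min lexx orbT.
exists (e / 8); first lra.
exists (cauchy_prod a b); split; last by move=> y; exact: psum_at_cvgM.
have [[M aM] _] := fa; have [[M' bM] _] := gb.
exists (M * M') => k.
(* Moving the power of [e / 8] into the Cauchy product bounds both factors with ratio 1/8; then (k +
   1) / 8^k <= (2/8)^k <= 1. *)
rewrite -[e / 8]gtr0_norm ?divr_gt0// -normrX -normrM cauchy_prod_expr.
have e8 : `|e / 8| <= 8^-1 * e by rewrite gtr0_norm ?divr_gt0//; lra.
rewrite (le_trans (cauchy_prod_bound (t := 8^-1) _ _ (coef_geometric_bound e0 e8 aM)
  (coef_geometric_bound e0 e8 bM)))//.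
have M0 : 0 <= M by have := le_trans (normr_ge0 _) (coef_geometric_bound e0 e8 aM 0%N); rewrite mulr1.
have M'0 : 0 <= M' by have := le_trans (normr_ge0 _) (coef_geometric_bound e0 e8 bM 0%N); rewrite mulr1.
rewrite mulrCA -[leRHS]mulr1 ler_wpM2l ?mulr_ge0//.
rewrite (le_trans (ler_wpM2r _ (natr_le_expn k)))// ?exprn_ge0// -exprMn.
by rewrite exprn_ile1//; lra.
Qed.

Lemma analytic_at_cst c x : analytic_at (fun=> c) x.
Proof.
exists 1 => //; exists (fun k => if k == 0%N then c else 0); split.
  exists `|c| => k; rewrite expr1n mulr1; case: ifP => // _.
  by rewrite normr0.
move=> y _; apply/cvgrPdist_lt => e e0; near=> n.
rewrite (_ : series _ n = c) ?subrr ?normr0//.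
have n0 : (0 < n)%N by near: n; exact: nbhs_infty_gt.
rewrite /series/= big_ltn// mulr1 big_nat big1 ?addr0//.
by move=> k /andP[k0 _]; rewrite gtn_eqF// mul0r.
Unshelve. all: by end_near. Qed.

Lemma analytic_atX f x n : analytic_at f x -> analytic_at (fun y => f y ^+ n) x.
Proof.
move=> fx; elim: n => [|n ih].
  by under eq_fun do rewrite expr0; exact: analytic_at_cst.
by under eq_fun do rewrite exprS; exact: analytic_atM.
Qed.

Lemma psum_at0 f x r a : 0 < r -> psum_at f x r a -> f x = a 0%N.
Proof.
move=> r0 [_ /(_ x)]; rewrite subrr normr0 => /(_ r0) fx.
apply: (cvg_unique _ fx) => //=; apply/cvgrPdist_lt => e e0; near=> n.
rewrite (_ : series _ n = a 0%N) ?subrr ?normr0//.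
have n0 : (0 < n)%N by near: n; exact: nbhs_infty_gt.
rewrite /series/= big_ltn// mulr1 big_nat big1 ?addr0//.
by move=> k /andP[k0 _]; rewrite expr0n gtn_eqF// mulr0.
Unshelve. all: by end_near. Qed.

(** Coefficients of the reciprocal power series. Each one depends on all the earlier ones, so the
    whole list is carried to keep the recursion structural. *)
Fixpoint inv_coefs b (n : nat) : seq R :=
  if n is m.+1 then
    let s := inv_coefs b m in
    rcons s ((b 0%N)^-1 * ((m == 0)%:R - \sum_(i < m) s`_i * b (m - i)%N))
  else [::].

Definition inv_coef b n := (inv_coefs b n.+1)`_n.

Lemma size_inv_coefs b n : size (inv_coefs b n) = n.
Proof. by elim: n => //= n ih; rewrite size_rcons ih. Qed.

Lemma nth_inv_coefs b n i : (i < n)%N -> (inv_coefs b n)`_i = inv_coef b i.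
Proof.
elim: n => // n ih; rewrite ltnS leq_eqVlt => /predU1P[->//|i_n].
by rewrite /= nth_rcons size_inv_coefs i_n ih.
Qed.

Lemma inv_coefE b n : inv_coef b n =
  (b 0%N)^-1 * ((n == 0)%:R - \sum_(i < n) inv_coef b i * b (n - i)%N).
Proof.
rewrite {1}/inv_coef/= nth_rcons size_inv_coefs ltnn eqxx.
by congr (_ * (_ - _)); apply: eq_bigr => i _; rewrite nth_inv_coefs.
Qed.

Lemma cauchy_prod_inv_coef b k : b 0%N != 0 ->
  cauchy_prod (inv_coef b) b k = (k == 0)%:R.
Proof.
move=> b0; rewrite /cauchy_prod big_ord_recr/= subnn [inv_coef b k]inv_coefE.
by rewrite mulrAC mulVf// mul1r addrC subrK.
Qed.

(** Strong induction on the recurrence [inv_coefE]: at radius s = q r the earlier coefficients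
    contribute at most M / |b_0| times the sum of q^(k - i), which is at most 1 for small q. *)
Lemma inv_coef_bound b r M : 0 < r -> b 0%N != 0 ->
  (forall k, `|b k| * r ^+ k <= M) ->
  exists2 s, 0 < s <= r & forall k, `|inv_coef b k| * s ^+ k <= `|b 0%N|^-1.
Proof.
move=> r0 b0 bM.
have B0 : 0 < `|b 0%N| by rewrite normr_gt0.
have M0 : 0 < M by have := bM 0%N; rewrite mulr1; exact: lt_le_trans.
(* with this ratio, M/|b_0| times the sum of q^j over j >= 1 is at most 1 *)
pose q := Num.min 2^-1 (`|b 0%N| / (2 * M)).
have q0 : 0 < q by rewrite lt_min invr_gt0 ltr0n divr_gt0// mulr_gt0.
have q2 : q <= 2^-1 by rewrite ge_min lexx.
have qM : 2 * q * M <= `|b 0%N|.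
  rewrite mulrAC mulrC -ler_pdivlMr ?mulr_gt0//.
  by rewrite /q ge_min lexx orbT.
have sumq m : \sum_(i < m) q ^+ (m - i) <= 2 * q.
  elim: m => [|m ih]; first by rewrite big_ord0 mulr_ge0// ltW.
  rewrite big_ord_recr/= subSnn expr1.
  under eq_bigr => i _ do rewrite subSn ?(ltnW (ltn_ord i))// exprS.
  by rewrite -mulr_sumr; nra.
exists (q * r).
  by rewrite mulr_gt0//= -[leRHS]mul1r ler_pM2r//; lra.
have s0 : 0 < q * r by rewrite mulr_gt0.
elim/ltn_ind => k ih; case: k ih => [|k] ih.
  by rewrite inv_coefE big_ord0 subr0 !mulr1 normfV.
rewrite inv_coefE sub0r normrM normfV normrN -mulrA -[leRHS]mulr1.
rewrite ler_pM2l ?invr_gt0// -[(q * r) ^+ k.+1]gtr0_norm ?exprn_gt0//.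
rewrite -normrM mulr_suml (le_trans (ler_norm_sum _ _ _))//.
rewrite (@le_trans _ _ (\sum_(i < k.+1) `|b 0%N|^-1 * M * q ^+ (k.+1 - i)))//.
  apply: ler_sum => i _.
  rewrite !normrM (gtr0_norm (exprn_gt0 _ s0)).
  have -> : (q * r) ^+ k.+1 = (q * r) ^+ i * (q * r) ^+ (k.+1 - i).
    by rewrite -exprD subnKC// ltnW.
  rewrite mulrACA -[leRHS]mulrA.
  apply: ler_pM; rewrite ?mulr_ge0// ?exprn_ge0// ?(ltW s0)//.
  - exact: ih.
  - by rewrite exprMn mulrCA mulrC ler_pM2r ?exprn_gt0.
rewrite -mulr_sumr -mulrA ler_pdivrMl// mulr1 (le_trans _ qM)//.
by rewrite mulrC ler_pM2r.
Qed.

(** The reciprocal coefficients grow at most geometrically, hence define a function [g] near [x]; it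
    is then identified with the inverse of [f] through the Cauchy product. *)
Lemma analytic_atV f x : f x != 0 -> analytic_at f x ->
  analytic_at (fun y => (f y)^-1) x.
Proof.
move=> fx0 [r r0 [b fb]]; have b0 : b 0%N != 0 by rewrite -(psum_at0 r0 fb).
have [[M bM] _] := fb.
have [s /andP[s0 sr] aM] := inv_coef_bound r0 b0 bM.
set a := inv_coef b in aM.
have {}fb := psum_at_le s0 sr fb.
pose g y := limn (series (fun k => a k * (y - x) ^+ k)).
have ga : psum_at g x s a.
  split; first by exists `|b 0%N|^-1.
  move=> y ys; apply: (@cvg_series_geometric_bound _ `|b 0%N|^-1 (`|y - x| / s)).
  - by rewrite divr_ge0// ltW.
  - by rewrite ltr_pdivrMr// mul1r.
  - by apply: (coef_geometric_bound s0) => //; rewrite divfK// gt_eqF.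
exists (s / 8); first lra.
exists a; split.
  have s8 : s / 8 <= s by lra.
  by have [] := psum_at_le (divr_gt0 s0 (ltr0n _ 8)) s8 ga.
move=> y ys; have gf := psum_at_cvgM s0 ga fb ys.
(* The product series has coefficients 1, 0, 0, ... This also shows that [f] has no zero on the
   smaller disc. *)
have g1 : g y * f y = 1.
  apply: (cvg_unique _ gf) => //=; apply/cvgrPdist_lt => e e0; near=> n.
  rewrite (_ : series _ n = 1) ?subrr ?normr0//.
  have n0 : (0 < n)%N by near: n; exact: nbhs_infty_gt.
  rewrite /series/= big_ltn// cauchy_prod_inv_coef// mulr1 big_nat big1 ?addr0//.
  by move=> k /andP[k0 _]; rewrite cauchy_prod_inv_coef// gtn_eqF// mul0r.
have fy0 : f y != 0 by apply: contra_eq_neq g1 => ->; rewrite mulr0 eq_sym oner_eq0.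
have -> : (f y)^-1 = g y by rewrite -[LHS]mul1r -g1 mulfK.
by apply: ga.2; lra.
Unshelve. all: by end_near. Qed.

(** The tail is at most the geometric sum 4/3 M 4^-n, and 4/3 is rounded up to 2. *)
Lemma series_tail_bound u (U M : R) n :
  (forall k, `|u k| <= M * 4^-1 ^+ k) -> series u @ \oo --> U ->
  `|U - series u n| <= 2 * M * 4^-1 ^+ n.
Proof.
move=> uM cu.
have M0 : 0 <= M by have := le_trans (normr_ge0 _) (uM 0%N); rewrite mulr1.
have cU : `|series u m - series u n| @[m --> \oo] --> `|U - series u n|.
  by apply: cvg_norm; apply: cvgB => //; exact: cvg_cst.
(* Subtracting [4^-1 ^+ m] makes the induction close: a step adds at most M 4^-m while the bound
   grows by 3/2 of that. *)
have sum_le m : (n <= m)%N ->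
    \sum_(n <= k < m) `|u k| <= 2 * M * (4^-1 ^+ n - 4^-1 ^+ m).
  elim: m => [|m ih] nm.
    by move: nm; rewrite leqn0 => /eqP ->; rewrite big_geq// subrr mulr0.
  move: nm; rewrite leq_eqVlt => /predU1P[->|].
    by rewrite big_geq// subrr mulr0.
  rewrite ltnS => nm; rewrite big_nat_recr//=.
  rewrite (le_trans (lerD (ih nm) (uM m)))// exprS.
  have : 0 <= M * 4^-1 ^+ m by rewrite mulr_ge0// exprn_ge0.
  by nra.
rewrite -(cvg_lim _ cU)//; apply: limr_le; first by apply/cvg_ex; eexists; exact: cU.
near=> m; have nm : (n <= m)%N by near: m; exact: nbhs_infty_ge.
rewrite sub_series_geq// (le_trans (ler_norm_sum _ _ _))//.
rewrite (le_trans (sum_le _ nm))// ler_wpM2l ?mulr_ge0//.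
by rewrite lerBlDr lerDl exprn_ge0.
Unshelve. all: by end_near. Qed.

(** Both sides run over the triangle j <= m < n, with m = k + j on the right. *)
Lemma exchange_triangle (F : nat -> nat -> R) n :
  \sum_(m < n) \sum_(j < m.+1) F m j =
  \sum_(j < n) \sum_(k < n - j) F (k + j)%N j.
Proof.
elim: n => [|n ih]; first by rewrite !big_ord0.
rewrite big_ord_recr/= ih [RHS]big_ord_recr/= subSnn big_ord1 add0n.
rewrite big_ord_recr/= addrA; congr (_ + _); rewrite -big_split/=.
by apply: eq_bigr => j _; rewrite subSn 1?ltnW// big_ord_recr/= subnK// ltnW.
Qed.

(** Recentering at [x]: y^m is expanded binomially in d = y - x and regrouped by powers of d, so the
    new coefficient [A j] is the sum over k of c_(k+j) C(k+j, j) x^k. *)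
Lemma analytic_at_entire f (c : nat -> R) :
  (forall r, 0 < r -> exists M, forall k, `|c k| * r ^+ k <= M) ->
  (forall y, series (fun k => c k * y ^+ k) @ \oo --> f y) ->
  forall x, analytic_at f x.
Proof.
move=> cM cf x; pose r := `|x| + 1.
have r0 : 0 < r by rewrite ltr_wpDl.
(* The factor 4 leaves a ratio 1/4 in both indices once C(k+j, j) |x|^k is bounded by r^(k+j). *)
have [|M {}cM] := cM (4 * r); first by rewrite mulr_gt0.
pose w j k := c (k + j)%N * ('C(k + j, j)%:R * x ^+ k).
have M0 : 0 <= M by have := le_trans _ (cM 0%N); rewrite mulr1; exact.
have wM j k : `|w j k| <= M * 4^-1 ^+ j * 4^-1 ^+ k.
  rewrite -mulrA -exprD -ler_pdivrMr ?exprn_gt0// -exprVn invrK.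
  rewrite addnC (le_trans _ (cM (k + j)%N))// /w normrM -mulrA ler_wpM2l//.
  rewrite exprMn mulrC ler_wpM2l ?exprn_ge0// exprDn.
  (* C(k+j, j) |x|^k is the term of index j in the expansion of (|x| + 1)^(k+j). *)
  rewrite (bigD1 (inord j))//= inordK; last by rewrite ltnS leq_addl.
  rewrite addnK expr1n mulr1 normrM normrX ger0_norm// mulr_natl lerDl.
  by apply: sumr_ge0 => i _; rewrite mulrn_wge0// mulr_ge0// ?exprn_ge0.
have cw j : cvgn (series (w j)).
  by apply: cvg_series_geometric_bound (wM j) => //; lra.
pose A j := limn (series (w j)).
have tail j n : `|A j - series (w j) n| <= 2 * M * 4^-1 ^+ (n + j).
  rewrite (le_trans (series_tail_bound n (wM j) (cw j)))//.
  by rewrite mulrA -[leLHS]mulrA -exprD addnC.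
exists 1 => //; exists A; split.
  exists (2 * M) => j; rewrite expr1n mulr1.
  have := tail j 0%N; rewrite /series/= big_geq// subr0 => /le_trans; apply.
  by rewrite -[leRHS]mulr1 ler_wpM2l ?mulr_ge0// exprn_ile1//; lra.
move=> y xy; set d := y - x.
pose D n := series (fun j => A j * d ^+ j) n - series (fun k => c k * y ^+ k) n.
suff D0 : D @ \oo --> (0 : R).
  have -> : series (fun j => A j * d ^+ j) =
      (fun n => series (fun k => c k * y ^+ k) n + D n).
    by apply/funext => n; rewrite /D addrC subrK.
  by rewrite -[f y]addr0; apply: cvgD => //; exact: cf.
have DE n : `|D n| <= 2 * M * 2^-1 ^+ n.
  (* Cutting the triangle at n leaves, for each j, the tail of [A j] from n - j on, of size at most
     2 M 4^-n. There are n of them, |d| < 1, and n 4^-n <= 2^-n. *)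
  have -> : D n = \sum_(j < n) (A j - series (w j) (n - j)%N) * d ^+ j.
    rewrite /D /series/= !big_mkord.
    have yE m : c m * y ^+ m =
        \sum_(j < m.+1) c m * (x ^+ (m - j) * d ^+ j *+ 'C(m, j)).
      by rewrite -mulr_sumr -exprDn /d addrC subrK.
    under [X in _ - X]eq_bigr => m _ do rewrite yE.
    rewrite (exchange_triangle (fun m j => c m * (x ^+ (m - j) * d ^+ j *+ 'C(m, j)))).
    rewrite -sumrB; apply: eq_bigr => j _; rewrite mulrBl big_mkord mulr_suml.
    congr (_ - _); apply: eq_bigr => k _; rewrite addnK /w.
    by rewrite -mulrnAl mulrnAl -mulr_natl !mulrA.
  rewrite (le_trans (ler_norm_sum _ _ _))//.
  apply: (@le_trans _ _ (\sum_(j < n) 2 * M * 4^-1 ^+ n)).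
    apply: ler_sum => j _; rewrite normrM -[leRHS]mulr1 ler_pM//.
      by rewrite (le_trans (tail _ _))// subnK// ltnW.
    by rewrite normrX exprn_ile1// ltW.
  rewrite sumr_const card_ord -[leLHS]mulr_natl mulrCA ler_wpM2l ?mulr_ge0//.
  have -> : 2^-1 = 2 * 4^-1 :> R by lra.
  rewrite exprMn ler_wpM2r ?exprn_ge0// (le_trans _ (natr_le_expn n))//.
  by rewrite ler_nat.
apply/norm_cvg0P; apply: (squeeze_cvgr (f := fun=> 0) (h := geometric (2 * M) 2^-1)).
- by apply: nearW => n; rewrite normr_ge0 DE.
- exact: cvg_cst.
- by apply: cvg_geometric; rewrite ger0_norm; lra.
Qed.

End power_series.

(** * Laws with a density *)

Section density.
Context d (T : measurableType d) (R : realType).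
Variables (mu nu : {finite_measure set T -> \bar R}) (p : T -> R).
Hypothesis mp : measurable_fun setT p.
Hypothesis nuE : forall A, measurable A -> nu A = (\int[mu]_(x in A) (p x)%:E)%E.
Local Open Scope ereal_scope.

(** [p] and the Radon-Nikodym derivative of [nu] have the same integral over every measurable set,
    so they agree almost everywhere, and the change of variables for the derivative carries over to
    [p]. *)
Lemma ge0_integral_density f : measurable_fun setT f -> (forall x, 0 <= f x) ->
  \int[nu]_x f x = \int[mu]_x (f x * (p x)%:E).
Proof.
move=> mf f0.
have numu : nu `<< mu.
  apply/null_content_dominatesP => A mA muA; rewrite nuE//.
  by apply: null_set_integral => //; exact/measurable_EFinP/measurable_funTS.
rewrite -(Radon_Nikodym_SigmaFinite.change_of_variables numu)//.
have mRN : measurable_fun setT (Radon_Nikodym_SigmaFinite.f nu mu).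
  exact: measurable_int (Radon_Nikodym_SigmaFinite.f_integrable numu).
apply: ae_eq_integral => //.
- exact: emeasurable_funM.
- by apply: emeasurable_funM => //; exact/measurable_EFinP.
- apply: ae_eqe_mul2l; apply: integral_ae_eq => //.
  + exact: (Radon_Nikodym_SigmaFinite.f_integrable numu).
  + exact/measurable_EFinP.
  + move=> E _ mE; rewrite -nuE//.
    by rewrite (Radon_Nikodym_SigmaFinite.f_integral numu).
Qed.

End density.

Section iid_density.
Context d (T : measurableType d) (R : realType).
Variables (mu nu : {finite_measure set T -> \bar R}) (p : T -> R).
Hypotheses (mp : measurable_fun setT p) (p0 : forall x, (0 <= p x)%R).
Hypothesis nuE : forall A, measurable A -> nu A = (\int[mu]_(x in A) (p x)%:E)%E.
Local Open Scope ereal_scope.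

Definition tuple_density N (x : N.-tuple T) : R := (\prod_(i < N) p (tnth x i))%R.

Lemma tuple_density_ge0 N (x : N.-tuple T) : (0 <= tuple_density x)%R.
Proof. exact: prodr_ge0. Qed.

Lemma measurable_tuple_density N : measurable_fun setT (@tuple_density N).
Proof.
apply: measurable_prod => i _; apply: measurableT_comp => //.
exact: measurable_tnth.
Qed.

Lemma tuple_density_cons N (x : T) (y : N.-tuple T) :
  tuple_density (Defs.cons_tuple (x, y)) = (p x * tuple_density y)%R.
Proof.
rewrite /tuple_density big_ord_recl tnth0; congr (_ * _)%R.
by apply: eq_bigr => i _; rewrite tnthS.
Qed.

Lemma ge0_integral_cons_law (P : {finite_measure set T -> \bar R}) N
    (Q : {finite_measure set (N.-tuple T) -> \bar R}) (f : N.+1.-tuple T -> \bar R) :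
  measurable_fun setT f -> (forall x, 0 <= f x) ->
  \int[cons_law P Q]_x f x = \int[P]_x \int[Q]_y f (Defs.cons_tuple (x, y)).
Proof.
move=> mf f0; have mc := @measurable_cons_tuple _ T N.
rewrite (ge0_integral_pushforward mc)//= preimage_setT fubini_tonelli1//.
exact: measurableT_comp.
Qed.

(** By induction on [N]: Tonelli separates the first coordinate, the induction hypothesis treats the
    others, and [ge0_integral_density] treats the first. *)
Lemma ge0_integral_iid_density N (f : N.-tuple T -> \bar R) :
  measurable_fun setT f -> (forall x, 0 <= f x) ->
  \int[iid_law nu N]_x f x = \int[iid_law mu N]_x (f x * (tuple_density x)%:E).
Proof.
elim: N f => [|N ih] f mf f0.
  by apply: eq_integral => x _; rewrite /tuple_density big_ord0 mule1.
have mc := @measurable_cons_tuple _ T N.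
have mfd : measurable_fun setT (fun x => f x * (tuple_density x)%:E).
  by apply: emeasurable_funM => //; apply/measurable_EFinP; exact: measurable_tuple_density.
rewrite !ge0_integral_cons_law//; last first.
  by move=> x; rewrite mule_ge0// lee_fin tuple_density_ge0.
have mfc : measurable_fun setT (f \o @Defs.cons_tuple _ T N) by exact: measurableT_comp.
have mfx x : measurable_fun setT (fun y => f (Defs.cons_tuple (x, y))).
  by apply: (measurableT_comp mfc); exact: measurable_pair1.
have md2 : measurable_fun setT (fun z : T * N.-tuple T => (tuple_density z.2)%:E).
  by apply/measurable_EFinP; apply: measurableT_comp => //; exact: measurable_tuple_density.
pose G (z : T * N.-tuple T) := f (Defs.cons_tuple z) * (tuple_density z.2)%:E.
(* The one-variable formula is applied to this inner integral, which must be measurable in the first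
   coordinate. *)
have mG : measurable_fun setT (fubini_F (iid_law mu N) G).
  apply: measurable_fun_fubini_tonelli_F; first exact: emeasurable_funM.
  by move=> z; rewrite mule_ge0// lee_fin tuple_density_ge0.
under eq_integral => x _ do rewrite ih//.
rewrite (ge0_integral_density mp nuE).
- apply: eq_integral => x _; rewrite -ge0_integralZr//.
  + by apply: eq_integral => y _; rewrite tuple_density_cons -muleA -EFinM mulrC.
  + apply: emeasurable_funM => //.
    by apply/measurable_EFinP; exact: measurable_tuple_density.
  + by move=> y _; rewrite mule_ge0// lee_fin tuple_density_ge0.
  + by rewrite lee_fin.
- exact: mG.
- move=> x; apply: integral_ge0 => y _.
  by rewrite mule_ge0// lee_fin tuple_density_ge0.
Qed.

(** Positive and negative parts are treated separately; a nonnegative density commutes with the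
    maxima that define them. *)
Lemma integral_iid_density N (f : N.-tuple T -> \bar R) : measurable_fun setT f ->
  \int[iid_law nu N]_x f x = \int[iid_law mu N]_x (f x * (tuple_density x)%:E).
Proof.
move=> mf; rewrite integralE [RHS]integralE.
rewrite (ge0_integral_iid_density (measurable_funepos mf))//.
rewrite (ge0_integral_iid_density (measurable_funeneg mf))//.
congr (_ - _); apply: eq_integral => x _.
  by rewrite !funeposE muleC [in RHS]muleC maxe_pMr ?mule0// lee_fin tuple_density_ge0.
by rewrite !funenegE -mulNe muleC [in RHS]muleC maxe_pMr ?mule0// lee_fin tuple_density_ge0.
Qed.

End iid_density.

(** * The Gamma function and the Bessel series *)

Section gamma.
Context {R : realType}.
Local Notation mu := (@lebesgue_measure R).
Implicit Types (z t : R).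

Let f z t := t `^ (z - 1) * expR (- t).

Let mf z : measurable_fun setT (EFin \o f z).
Proof.
apply/measurable_EFinP; apply: measurable_funM => //.
by apply: (@measurableT_comp _ _ _ _ _ _ (@expR R)) => //; exact: oppr_measurable.
Qed.

Let f_ge0 z t : (0 <= (EFin \o f z) t)%E.
Proof. by rewrite lee_fin mulr_ge0// ?powR_ge0// expR_ge0. Qed.

(** The integrand may blow up at 0, so the antiderivative t^z / z is used on compact intervals that
    exhaust the domain. The offset in [k.+2] keeps their left endpoints strictly below 1. *)
Lemma integral_powR_itv01 z : 0 < z ->
  (\int[mu]_(t in `]0%R, 1%R]) (t `^ (z - 1))%:E <= (z^-1)%:E)%E.
Proof.
move=> z0; pose F (k : nat) : set R := [set` `[k.+2%:R^-1, 1%R]].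
have F0 k : 0 < k.+2%:R^-1 :> R by rewrite invr_gt0.
have F1 k : k.+2%:R^-1 < 1 :> R by rewrite invf_lt1// ltr1n.
have UF : `]0, 1]%classic = \bigcup_k F k.
  apply/seteqP; split => [t /=|t [k _]]; rewrite /F/= !in_itv/=.
    move=> /andP[t0 t1]; exists (Num.truncn t^-1) => //=.
    rewrite in_itv/= t1 andbT invf_ple ?posrE//.
    rewrite ltW// (lt_le_trans (truncnS_gt _))// ler_nat.
    by [].
  by move=> /andP[kt ->]; rewrite andbT (lt_le_trans (F0 k)).
have mpow : measurable_fun setT (fun t : R => (t `^ (z - 1))%:E).
  by apply/measurable_EFinP; exact: measurable_powR.
have cF : (\int[mu]_(t in F k) (t `^ (z - 1))%:E @[k --> \oo] -->
    \int[mu]_(t in \bigcup_k F k) (t `^ (z - 1))%:E)%E.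
  apply: ge0_nondecreasing_set_cvg_integral.
  - move=> i j ij; apply/subsetPset => t; rewrite /F/= !in_itv/= => /andP[it ->].
    rewrite andbT (le_trans _ it)// lef_pV2 ?posrE// ler_nat//.
  - by move=> i; exact: measurable_itv.
  - by move=> i; exact: measurable_funTS.
  - by move=> i t _; rewrite lee_fin powR_ge0.
rewrite UF -(cvg_lim _ cF)//; apply: lime_le; first by apply/cvg_ex; eexists; exact: cF.
apply: nearW => k.
have dpow t : 0 < t -> is_derive t 1 (fun s : R => z^-1 * s `^ z) (t `^ (z - 1)).
  move=> t0; have := is_derive1_powR z t0 => dz.
  apply: is_derive_eq => //; rewrite /GRing.scale/=.
  by rewrite mulrA mulVf ?mul1r// gt_eqF.
have cpow t c : 0 < t -> {for t, continuous (fun s : R => s `^ c)}.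
  move=> t0; apply: differentiable_continuous; apply/derivable1_diffP.
  by have [] := is_derive1_powR c t0.
have cpowz t : 0 < t -> {for t, continuous (fun s : R => z^-1 * s `^ z)}.
  by move=> t0; apply: cvgM; [exact: cvg_cst|exact: cpow].
rewrite /F (@continuous_FTC2 _ _ (fun s : R => z^-1 * s `^ z)) ?F1//.
- rewrite -EFinB lee_fin powR1 mulr1 lerBlDr lerDl.
  by rewrite mulr_ge0 ?powR_ge0// invr_ge0 ltW.
- apply: continuous_in_subspaceT => t; rewrite inE/= in_itv/= => /andP[ta _].
  by apply: cpow; exact: lt_le_trans ta.
- split.
  + move=> t; rewrite in_itv/= => /andP[ta _].
    by have [] := dpow t (lt_trans (F0 k) ta).
  + by apply: cvg_at_right_filter; exact: cpowz.
  + by apply: cvg_at_left_filter; apply: cpowz.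
- move=> t; rewrite in_itv/= => /andP[ta _].
  by rewrite derive1E; apply: derive_val; exact: (dpow t (lt_trans (F0 k) ta)).
Qed.

(** The integral is split at 1: the power dominates near 0, and a multiple of the exponential
    density of rate 1/2 dominates near infinity. *)
Lemma integral_Gamma_lty z : 0 < z ->
  (\int[mu]_(t in `]0%R, +oo[) (t `^ (z - 1) * expR (- t))%:E < +oo)%E.
Proof.
move=> z0; have D : `]0, +oo[%classic = `]0, 1]%classic `|` `]1, +oo[%classic :> set R.
  apply/seteqP; split => t /=; rewrite !in_itv/= ?andbT.
    by move=> t0; case: (leP t 1) => t1; [left|right]; rewrite ?t0.
  by case=> [/andP[]//|/(lt_trans _)->].
rewrite D ge0_integral_setU//=; last 3 first.
- by apply: measurable_funTS; exact: (mf z).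
- by move=> t _; exact: f_ge0.
- apply/disj_setPS => t /=; rewrite !in_itv/= andbT => -[/andP[_ t1] t2].
  by have := lt_le_trans t2 t1; rewrite ltxx.
apply: lte_add_pinfty.
  apply: (le_lt_trans _ (ltry z^-1)); apply: le_trans (integral_powR_itv01 z0).
  apply: ge0_le_integral => //.
  - by move=> t _; exact: f_ge0.
  - by apply: measurable_funTS; exact: (mf z).
  - by apply: measurable_funTS; apply/measurable_EFinP; exact: measurable_powR.
  - move=> t /=; rewrite in_itv/= => /andP[t0 _].
    rewrite lee_fin -[leRHS]mulr1 ler_wpM2l ?powR_ge0//.
    by rewrite expR_le1 oppr_le0 ltW.
(* For t > 1, t^(z-1) <= t^n <= n! 2^n e^(t/2), because (t/2)^n / n! is a term of the series of
   e^(t/2). The leading 2 in [C] cancels the factor 1/2 of the exponential density. *)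
pose n := (Num.truncn z).+1.
pose C : R := 2 * (n`!%:R * 2 ^+ n).
have C0 : 0 <= C by rewrite !mulr_ge0.
have r0 : 0 < 2^-1 :> R by rewrite invr_gt0.
have ie := integrable_exponential_pdf r0.
apply: (@le_lt_trans _ _ (\int[mu]_t (C%:E * (exponential_pdf 2^-1 t)%:E))%E); last first.
  rewrite ge0_integralZl//.
  - by rewrite integral_exponential_pdf// mule1 ltry.
  - by apply/measurable_EFinP; exact: measurable_exponential_pdf.
  - by move=> t _; rewrite lee_fin exponential_pdf_ge0.
have mC : measurable_fun setT (fun t => C%:E * (exponential_pdf 2^-1 t)%:E)%E.
  by apply: emeasurable_funM => //; apply/measurable_EFinP; exact: measurable_exponential_pdf.
have C_ge0 t : (0 <= C%:E * (exponential_pdf 2^-1 t)%:E)%E.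
  by rewrite -EFinM lee_fin mulr_ge0// exponential_pdf_ge0.
apply: (@le_trans _ _ (\int[mu]_(t in `]1%R, +oo[) (C%:E * (exponential_pdf 2^-1 t)%:E))%E); last first.
  by apply: ge0_subset_integral.
apply: ge0_le_integral => //.
- by move=> t _; exact: f_ge0.
- by apply: measurable_funTS; exact: (mf z).
- exact: measurable_funTS.
move=> t /=; rewrite in_itv/= andbT => t1.
have t0 : 0 < t by exact: lt_trans t1.
rewrite (exponential_pdfE _ (ltW t0)) -EFinM lee_fin /C.
rewrite mulrACA mulfV// mul1r.
have -> : - t = - 2^-1 * t + - 2^-1 * t by lra.
rewrite expRD mulrA ler_wpM2r ?expR_ge0//.
rewrite -ler_pdivlMr ?expR_gt0// -expRN mulNr opprK.
apply: (@le_trans _ _ (t ^+ n)).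
  rewrite -powR_mulrn ?(ltW t0)//; apply: ler_powR; first exact: ltW.
  by rewrite lerBlDr (le_trans (ltW (truncnS_gt _)))// lerDl.
have := expR_ge1Dxn n.-1 (ltW (divr_gt0 t0 (ltr0n R 2))).
rewrite prednK// (mulrC t) => /(le_trans (ltW (ltr_pwDl ltr01 (lexx _)))).
by rewrite exprMn exprVn -mulrA ler_pdivrMl ?exprn_gt0// ler_pdivrMr ?ltr0n ?fact_gt0// mulrAC (mulrC (2 ^+ n)).
Qed.

(** On [1, 2] one has t^(z-1) >= 1/t >= 1/2 and e^-t >= e^-2. Being uniform in [z], the bound gives
    both positivity and decay of the Bessel coefficients. Finiteness of the integral is what lets
    the real-valued [Gamma] be compared with it. *)
Lemma Gamma_ge z : 0 < z -> expR (- 2) / 2 <= Gamma z.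
Proof.
move=> z0; rewrite -lee_fin /Gamma /Rintegral fineK; last first.
  by rewrite ge0_fin_numE ?integral_Gamma_lty//; apply: integral_ge0 => t _; exact: f_ge0.
apply: (@le_trans _ _ (\int[mu]_(t in `[1%R, 2%R]) (f z t)%:E)%E); last first.
  apply: ge0_subset_integral => //; first by apply: measurable_funTS; exact: (mf z).
    by move=> t _; exact: f_ge0.
  by move=> t /=; rewrite !in_itv/= andbT => /andP[t1 _]; exact: lt_le_trans t1.
apply: (@le_trans _ _ (\int[mu]_(t in `[1%R, 2%R]) (expR (- 2) / 2)%:E)%E).
  rewrite integral_cst//= lebesgue_measure_itv/= lte_fin ltr1n/= -EFinB.
  by rewrite (_ : 2 - 1 = 1 :> R) ?mule1//; lra.
apply: ge0_le_integral => //.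
- by apply: measurable_funTS; exact: (mf z).
move=> t /=; rewrite in_itv/= => /andP[t1 t2].
rewrite lee_fin /f mulrC ler_pM ?expR_ge0 ?invr_ge0//; last by rewrite ler_expR lerN2.
have t0 : 0 < t by exact: lt_le_trans t1.
apply: (@le_trans _ _ (t `^ (-1))).
  by rewrite powR_inv1 ?(ltW t0)// lef_pV2 ?posrE.
by apply: ler_powR => //; lra.
Qed.

End gamma.

(** * Power series with infinite radius of convergence *)

Section entire.
Context {R : realType}.
Implicit Types (c : nat -> R) (x y r s : R).

Definition entire_coef c := forall r, 0 < r -> exists M, forall k, `|c k| * r ^+ k <= M.

Lemma entire_coef_cvg c y : entire_coef c -> cvgn (series (fun k => c k * y ^+ k)).
Proof.
move=> cE; have r0 : 0 < 2 * (`|y| + 1) by rewrite mulr_gt0// ltr_wpDl.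
have [M cM] := cE _ r0.
apply: (@cvg_series_geometric_bound _ _ M 2^-1) => //; first lra.
by apply: (coef_geometric_bound r0) => //; rewrite mulKf// lerDl.
Qed.

Lemma exprn_fact_le_expR r k : 0 <= r -> r ^+ k / k`!%:R <= expR r.
Proof.
move=> r0; case: k => [|k]; first by rewrite divr1 expr0 -expR0 ler_expR.
by rewrite (le_trans _ (expR_ge1Dxn k r0))// lerDr.
Qed.

(** (s r)^k / k! is a term of the series of e^(s r), hence bounded in k. Both the Bessel and the
    Laplace coefficients are handled this way. *)
Lemma entire_coef_fact c (K s : R) : 0 <= s ->
  (forall k, `|c k| <= K * (s ^+ k / k`!%:R)) -> entire_coef c.
Proof.
move=> s0 cK r r0; have K0 : 0 <= K.
  by have := le_trans (normr_ge0 _) (cK 0%N); rewrite divr1 mulr1.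
exists (K * expR (s * r)) => k.
rewrite (le_trans (ler_wpM2r _ (cK k))) ?exprn_ge0 ?(ltW r0)//.
rewrite -mulrA ler_wpM2l// mulrAC -exprMn exprn_fact_le_expR//.
by rewrite mulr_ge0// ltW.
Qed.

End entire.

(** * The Bessel series and the normalizing constant *)

Section bessel_series.
Context {R : realType} (n : nat).
Hypothesis n0 : (0 < n)%N.
Implicit Types (x u : R).

(** With nu = n/2 - 1, these are the coefficients of (x/2)^-nu I_nu(x) as a power series in u =
    x^2. *)
Definition bessel_coef (m : nat) : R :=
  4^-1 ^+ m / (m`!%:R * Gamma (n%:R / 2 - 1 + m%:R + 1)).

Definition bessel_sum u : R := limn (series (fun m => bessel_coef m * u ^+ m)).

Let c0 : 0 < expR (- 2) / 2 :> R. Proof. by rewrite divr_gt0// expR_gt0. Qed.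

Let Gamma_nu m : expR (- 2) / 2 <= Gamma (n%:R / 2 - 1 + m%:R + 1) :> R.
Proof.
apply: Gamma_ge; rewrite addrAC subrK ltr_wpDr//.
by rewrite divr_gt0// ltr0n.
Qed.

Lemma bessel_coef_gt0 m : 0 < bessel_coef m.
Proof.
rewrite divr_gt0// ?exprn_gt0// mulr_gt0// ?ltr0n ?fact_gt0//.
exact: lt_le_trans c0 (Gamma_nu m).
Qed.

Lemma entire_bessel_coef : entire_coef bessel_coef.
Proof.
apply: (@entire_coef_fact _ _ (expR (- 2) / 2)^-1 4^-1) => // k.
rewrite gtr0_norm ?bessel_coef_gt0// /bessel_coef [X in _ * X <= _]invfM.
rewrite [leLHS]mulrA [leLHS]mulrC.
rewrite ler_wpM2r ?divr_ge0// ?exprn_ge0//.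
by rewrite lef_pV2 ?posrE ?c0// (lt_le_trans c0).
Qed.

Lemma cvg_bessel_sum u :
  series (fun m => bessel_coef m * u ^+ m) @ \oo --> bessel_sum u.
Proof. exact: entire_coef_cvg entire_bessel_coef. Qed.

Lemma besselIE x : 0 < x ->
  besselI (n%:R / 2 - 1) x = (x / 2) `^ (n%:R / 2 - 1) * bessel_sum (x ^+ 2).
Proof.
move=> x0; rewrite /besselI; apply: cvg_lim => //.
have x20 : 0 < x / 2 by rewrite divr_gt0.
rewrite (_ : series _ = (fun k => (x / 2) `^ (n%:R / 2 - 1) *
    series (fun m => bessel_coef m * (x ^+ 2) ^+ m) k)).
  by apply: cvgM; [exact: cvg_cst|exact: cvg_bessel_sum].
apply/funext => k; rewrite /series/= mulr_sumr; apply: eq_bigr => m _.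
rewrite powRD; last by rewrite (gt_eqF x20) implybT.
rewrite -natrM powR_mulrn ?ltW// exprM.
rewrite -!mulrA; congr (_ * _); rewrite /bessel_coef.
rewrite (_ : (x / 2) ^+ 2 = 4^-1 * x ^+ 2); last first.
  by rewrite expr_div_n mulrC; congr (_^-1 * _); ring.
by rewrite exprMn mulrAC [RHS]mulrA.
Qed.

(** All coefficients are positive, which settles u >= 0. For -e < u < 0 with e <= 1, |u^m| <= e when
    m >= 1, so the sum is at least b_0 - e B(1). The margin below 0 provides the open neighborhood
    of [0, oo). *)
Lemma bessel_sum_gt0 : exists2 e : R, 0 < e & forall u, - e < u -> 0 < bessel_sum u.
Proof.
have b0 := bessel_coef_gt0 0.
have B1 : 0 <= bessel_sum 1.
  apply: limr_ge; first exact: cvg_bessel_sum.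
  apply: nearW => k; apply: sumr_ge0 => m _.
  by rewrite expr1n mulr1 ltW// bessel_coef_gt0.
(* The added 1 makes e B(1) < b_0 strict. *)
pose e : R := Num.min 1 (bessel_coef 0 / (bessel_sum 1 + 1)).
have B1' : 0 < bessel_sum 1 + 1 by rewrite ltr_wpDl.
have e0 : 0 < e by rewrite lt_min ltr01 divr_gt0.
have e1 : e <= 1 by rewrite ge_min lexx.
have eB : e * bessel_sum 1 < bessel_coef 0.
  have : e * (bessel_sum 1 + 1) <= bessel_coef 0.
    by rewrite -ler_pdivlMr// ge_min lexx orbT.
  by apply: lt_le_trans; rewrite ltr_pM2l// ltrDl.
exists e => // u eu; rewrite (@lt_le_trans _ _ (bessel_coef 0 - e * bessel_sum 1))//.
  by rewrite subr_gt0.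
have cl : (bessel_coef 0 - e * series (fun m => bessel_coef m * 1 ^+ m) k)
    @[k --> \oo] --> bessel_coef 0 - e * bessel_sum 1.
  apply: cvgB; first exact: cvg_cst.
  by apply: cvgM; [exact: cvg_cst|exact: cvg_bessel_sum].
apply: (ler_cvg_to cl (cvg_bessel_sum (u := u))).
near=> k; have k0 : (0 < k)%N by near: k; exact: nbhs_infty_gt.
rewrite /series/= lerBlDr mulr_sumr -big_split/= big_ltn//= expr0 mulr1.
rewrite -addrA lerDl addr_ge0//; first by apply: mulr_ge0; exact: ltW.
rewrite big_nat; apply: sumr_ge0 => m /andP[m0 _].
(* Beyond index 0 the terms combine into (e + u^m) b_m, which is nonnegative. *)
rewrite expr1n mulr1 (mulrC (bessel_coef m)) -mulrDl.
apply: mulr_ge0; last exact: ltW (bessel_coef_gt0 m).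
have [u0|u0] := leP 0 u; first by rewrite addr_ge0// ?exprn_ge0// ltW.
have ue : `|u| <= e by rewrite ltr0_norm// lerNl ltW.
rewrite -lerBlDr sub0r; apply: lerNnormlW; rewrite normrX.
rewrite (le_trans _ ue)// -(prednK m0) exprS ler_piMr// exprn_ile1//.
exact: le_trans e1.
Unshelve. all: by end_near. Qed.

(** The power x^nu in the numerator cancels against the (x/2)^nu of the Bessel function, leaving
    2^nu and a function of x^2 alone. *)
Lemma fvml_cstE x : 0 < x -> fvml_cst n x =
  2 `^ (n%:R / 2 - 1) / (2 * pi) `^ (n%:R / 2) / bessel_sum (x ^+ 2).
Proof.
move=> x0; rewrite /fvml_cst besselIE//.
have x20 : 0 < x / 2 by rewrite divr_gt0.
have p0 : 0 < (x / 2) `^ (n%:R / 2 - 1) by rewrite powR_gt0.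
have -> : x `^ (n%:R / 2 - 1) = 2 `^ (n%:R / 2 - 1) * (x / 2) `^ (n%:R / 2 - 1).
  by rewrite -powRM ?(ltW x20)// (mulrC 2) divfK.
set p := (x / 2) `^ _ in p0 *; set q := (2 * pi) `^ _.
by rewrite !invfM (mulrCA q^-1 p^-1) -[LHS]mulrA mulVKf ?gt_eqF// mulrA.
Qed.

Lemma fvml_cst_gt0 x : 0 < x -> 0 < fvml_cst n x.
Proof.
move=> x0; have [e e0 B0] := bessel_sum_gt0.
rewrite fvml_cstE// !divr_gt0 ?powR_gt0 ?mulr_gt0 ?pi_gt0//.
by apply: B0; rewrite (@lt_trans _ _ 0) ?oppr_lt0// exprn_gt0.
Qed.

End bessel_series.

(** * Laplace transforms *)

Section cosh_series.
Context {R : realType}.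
Implicit Types w : R.

Let u w (j : nat) := 2 * ((w ^+ 2) ^+ j / (j.*2)`!%:R).

(** The series of 2 cosh w: odd terms cancel, so k of its terms match 2k terms of the two
    exponential series. *)
Lemma cvg_expR_addN w :
  series (fun j => 2 * ((w ^+ 2) ^+ j / (j.*2)`!%:R)) @ \oo --> expR w + expR (- w).
Proof.
have -> : series (u w) = (fun k =>
    series (exp_coeff w) k.*2 + series (exp_coeff (- w)) k.*2).
  apply/funext => k; rewrite /series/= -big_split/=; elim: k => [|k ih].
    by rewrite !big_geq.
  rewrite doubleS !big_nat_recr//= ih -addrA; congr (_ + _).
  have E (v : R) : v ^+ k.*2 = (v ^+ 2) ^+ k by rewrite -exprM mul2n.
  by rewrite /exp_coeff /u/= !(exprSr _ k.*2) !E sqrrN; ring.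
have dbl : double @ \oo --> \oo.
  move=> A [N _ NA]; exists N => // k /= Nk; apply: NA => /=.
  by rewrite (leq_trans Nk)// -addnn leq_addr.
apply: cvgD.
  apply: (cvg_comp double (series (exp_coeff w)) dbl).
  exact: is_cvg_series_exp_coeff.
apply: (cvg_comp double (series (exp_coeff (- w))) dbl).
exact: is_cvg_series_exp_coeff.
Qed.

Lemma sum_le_expR_addN w k :
  \sum_(0 <= j < k) 2 * ((w ^+ 2) ^+ j / (j.*2)`!%:R) <= expR w + expR (- w).
Proof.
have cu := @cvg_expR_addN w.
have ge0 j : 0 <= u w j by rewrite mulr_ge0// divr_ge0// exprn_ge0// sqr_ge0.
have nd : nondecreasing_seq (series (u w)).
  by apply/nondecreasing_seqP => j; rewrite /series/= big_nat_recr//= lerDl.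
have := nondecreasing_cvgn_le nd (cvgP _ cu) k.
by rewrite (cvg_lim _ cu).
Qed.

Lemma expR_addN_le w (M : R) : `|w| <= M -> expR w + expR (- w) <= 2 * expR M.
Proof.
rewrite ler_norml => /andP[wM wM'].
rewrite mulr_natl mulr2n lerD// ler_expR//.
by rewrite lerNl.
Qed.

End cosh_series.

Section laplace_even.
Context d (T : measurableType d) (R : realType).
Variables (mu : {measure set T -> \bar R}) (D : set T).
Variables (theta Z : T -> R) (B : R).
Hypotheses (mD : measurable D) (mZ : measurable_fun D Z).
Hypothesis itheta : mu.-integrable D (EFin \o theta).
Hypothesis ZB : forall x, D x -> `|Z x| <= B.

Let mtheta : measurable_fun D theta.
Proof. by apply/measurable_EFinP; exact: measurable_int itheta. Qed.

Lemma integrable_mul_bounded (f : T -> R) (K : R) : measurable_fun D f ->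
  (forall x, D x -> `|f x| <= K) ->
  mu.-integrable D (fun x => (theta x * f x)%:E).
Proof.
move=> mf fK.
have mthf : measurable_fun D (fun x => (theta x * f x)%:E).
  by apply/measurable_EFinP; exact: measurable_funM.
apply: (le_integrable mD mthf _ (integrableZl mD K itheta)) => x Dx.
rewrite -EFinM !abse_EFin lee_fin !normrM mulrC ler_wpM2r//.
by rewrite (le_trans (fK _ Dx))// ler_norm.
Qed.

Let coef (j : nat) : R := \int[mu]_(x in D) (theta x * (2 * ((Z x ^+ 2) ^+ j / (j.*2)`!%:R))).

Let mpow j : measurable_fun D (fun x => 2 * ((Z x ^+ 2) ^+ j / (j.*2)`!%:R)).
Proof.
apply: measurable_funM => //; apply: measurable_funM => //.
by apply: measurable_funX; exact: measurable_funX.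
Qed.

(** Weakening (2j)! to j! gives the shape required by [entire_coef_fact]. *)
Let pow_le j x : D x -> `|2 * ((Z x ^+ 2) ^+ j / (j.*2)`!%:R)| <= 2 * ((B ^+ 2) ^+ j / j`!%:R).
Proof.
move=> Dx; have B0 : 0 <= B by rewrite (le_trans _ (ZB Dx)).
have p0 : 0 <= (Z x ^+ 2) ^+ j := exprn_ge0 j (sqr_ge0 _).
rewrite ger0_norm ?mulr_ge0 ?divr_ge0//.
rewrite ler_wpM2l// ler_pM ?invr_ge0//.
  rewrite lerXn2r ?nnegrE ?sqr_ge0// -real_normK ?num_real//.
  by rewrite lerXn2r ?nnegrE ?ZB.
rewrite lef_pV2 ?posrE ?ltr0n ?fact_gt0// ler_nat.
by rewrite leq_fact// -addnn leq_addr.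
Qed.

Let ipow j : mu.-integrable D (fun x => (theta x * (2 * ((Z x ^+ 2) ^+ j / (j.*2)`!%:R)))%:E).
Proof. exact: integrable_mul_bounded (mpow j) (pow_le j). Qed.

(** The integrand 2 theta cosh(s Z) is expanded in powers of s^2 and integrated term by term. *)
Lemma laplace_even : exists2 c : nat -> R, entire_coef c &
  forall s, series (fun j => c j * (s ^+ 2) ^+ j) @ \oo -->
    \int[mu]_(x in D) (theta x * expR (s * Z x)) +
    \int[mu]_(x in D) (theta x * expR (- (s * Z x))).
Proof.
have iabs : mu.-integrable D (EFin \o (fun x => `|theta x|)).
  by have := integrable_abse itheta.
exists coef.
  apply: (@entire_coef_fact _ _ (2 * \int[mu]_(x in D) `|theta x|) (B ^+ 2)).
    exact: sqr_ge0.
  move=> j; rewrite (le_trans (le_normr_Rintegral mD (ipow j)))//.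
  rewrite -mulrA (mulrC (Rintegral _ _ _)) mulrA -RintegralZl//.
  apply: le_Rintegral => //.
  - by have := integrable_abse (ipow j).
  - exact: (integrableZl mD _ iabs).
  - by move=> x Dx; rewrite normrM mulrC ler_wpM2r// pow_le.
move=> s.
have sZB x : D x -> `|s * Z x| <= `|s| * B.
  by move=> Dx; rewrite normrM ler_wpM2l// ZB.
have mexp (e : R) : measurable_fun D (fun x => expR (e * Z x)).
  by apply: measurableT_comp => //; apply: measurable_funM.
(* Stated for any [e] of the same modulus so as to serve both s and -s. *)
have iexp (e : R) : `|e| = `|s| -> mu.-integrable D (fun x => (theta x * expR (e * Z x))%:E).
  move=> es; apply: (@integrable_mul_bounded _ (expR (`|s| * B))) => // x Dx.
  rewrite ger0_norm ?expR_ge0// ler_expR (le_trans (ler_norm _))// normrM es.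
  by rewrite ler_wpM2l// ZB.
pose w x := s * Z x.
pose F k x := \sum_(0 <= j < k) theta x * (2 * ((Z x ^+ 2) ^+ j / (j.*2)`!%:R)) * (s ^+ 2) ^+ j.
pose L x := theta x * expR (w x) + theta x * expR (- w x).
have FE k x : F k x = theta x * \sum_(0 <= j < k) 2 * ((w x ^+ 2) ^+ j / (j.*2)`!%:R).
  rewrite mulr_sumr; apply: eq_bigr => j _; rewrite /w.
  have -> : ((s * Z x) ^+ 2) ^+ j = (s ^+ 2) ^+ j * (Z x ^+ 2) ^+ j by rewrite -[RHS]exprMn -[s ^+ 2 * _]exprMn.
  rewrite -!mulrA.
  by congr (_ * (_ * _)); rewrite [RHS]mulrCA (mulrC (_ ^-1)).
have iF k : mu.-integrable D (EFin \o F k) /\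
    \int[mu]_(x in D) F k x = series (fun j => coef j * (s ^+ 2) ^+ j) k.
  elim: k => [|k [iFk IFk]].
    have -> : F 0%N = cst 0 by apply/funext => x; rewrite /F big_geq.
    by split; [exact: integrable0|rewrite Rintegral_cst// mul0r /series/= big_geq].
  have iZ : mu.-integrable D (EFin \o (fun x => theta x * (2 * ((Z x ^+ 2) ^+ k / (k.*2)`!%:R)) * (s ^+ 2) ^+ k)).
    by apply: eq_integrable (integrableZl mD ((s ^+ 2) ^+ k) (ipow k)) => // x _ /=; rewrite -EFinM mulrC.
  have FS : F k.+1 = (fun x => F k x + theta x * (2 * ((Z x ^+ 2) ^+ k / (k.*2)`!%:R)) * (s ^+ 2) ^+ k).
    by apply/funext => x; rewrite /F big_nat_recr.
  split.
    by apply: eq_integrable (integrableD mD iFk iZ) => // x _ /=; rewrite -EFinD FS.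
  by rewrite FS RintegralD// IFk (RintegralZr _ mD (ipow k)) /series/= big_nat_recr.
have iL : mu.-integrable D (EFin \o L).
  apply: eq_integrable (integrableD mD (iexp s erefl) (iexp (- s) (normrN s))) => // x _ /=.
  by rewrite -EFinD mulNr.
have IL : \int[mu]_(x in D) L x = \int[mu]_(x in D) (theta x * expR (s * Z x)) +
    \int[mu]_(x in D) (theta x * expR (- (s * Z x))).
  rewrite RintegralD//; first exact: iexp.
  by have := iexp (- s) (normrN s); under eq_fun do rewrite mulNr.
rewrite -IL.
have -> : series (fun j => coef j * (s ^+ 2) ^+ j) = (fun k => \int[mu]_(x in D) F k x).
  by apply/funext => k; rewrite (iF k).2.
(* The cosh terms are nonnegative, so every partial sum lies below 2 cosh(s Z) <= 2 e^(|s| B). *)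
have [] := @dominated_convergence _ _ _ mu D mD (fun k => EFin \o F k) (EFin \o L)
    (fun x => (2 * expR (`|s| * B) * `|theta x|)%:E).
- by move=> k; exact: measurable_int (iF k).1.
- exact: measurable_int iL.
- apply: aeW => x Dx; apply: cvg_EFin; first exact: nearW.
  under eq_fun do rewrite /= FE.
  rewrite /L/= -mulrDr; apply: cvgM; first exact: cvg_cst.
  exact: cvg_expR_addN.
- exact: (integrableZl mD _ iabs).
- apply: aeW => x k Dx; rewrite abse_EFin lee_fin FE normrM mulrC ler_wpM2r//.
  rewrite ger0_norm; last first.
    by apply: sumr_ge0 => j _; rewrite mulr_ge0// divr_ge0// exprn_ge0// sqr_ge0.
  by rewrite (le_trans (sum_le_expR_addN _ _))// expR_addN_le// sZB.
move=> _ _ cI; apply: fine_cvg; rewrite fineK//.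
exact: integrable_fin_num.
Qed.

End laplace_even.

(** * Samples from the Fisher-von Mises-Langevin distribution *)

Section fvml_sample.
Context {R : realType} (n N : nat).
Implicit Types (mu : 'rV[R]_n) (kappa : R) (theta : N.-tuple 'rV[R]_n -> R).

Definition dotp_sum mu (x : N.-tuple 'rV[R]_n) : R := \sum_(i < N) dotp mu (tnth x i).

Local Notation sigmaN := (iid_law (surface_measure R n) N).
Local Notation S := (sphere_tuple R n N).

Lemma measurable_dotp_sum mu : measurable_fun setT (dotp_sum mu).
Proof.
apply: measurable_sum => i.
apply: (measurableT_comp (f := dotp mu)); last exact: measurable_tnth.
apply: measurable_fun_dotp => j //; exact: measurable_coord.
Qed.

Lemma dotp_sumN mu x : dotp_sum (- mu) x = - dotp_sum mu x.
Proof.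
rewrite /dotp_sum -sumrN; apply: eq_bigr => i _.
by rewrite -scaleN1r dotpZl mulN1r.
Qed.

(** Cauchy-Schwarz for each observation, applied to [mu] and to its opposite. *)
Lemma norm_dotp_sum_le mu x : sphere R n mu -> S x -> `|dotp_sum mu x| <= N%:R.
Proof.
move=> mu1 Sx; rewrite (le_trans (ler_norm_sum _ _ _))//.
rewrite -[X in _ <= X%:R](card_ord N) -sumr_const; apply: ler_sum => i _.
have le1 (m : 'rV[R]_n) : sphere R n m -> dotp m (tnth x i) <= 1.
  by move=> m1; rewrite (le_trans (dotp_le _ _))// m1 (Sx i) mulr1.
rewrite ler_norml le1// andbT lerNl -mulN1r -dotpZl scaleN1r le1//.
by rewrite /sphere/= enormN.
Qed.

Lemma tuple_density_fvml mu kappa (x : N.-tuple 'rV[R]_n) :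
  tuple_density (fvml_pdf mu kappa) x =
  fvml_cst n kappa ^+ N * expR (kappa * dotp_sum mu x).
Proof.
rewrite /tuple_density /fvml_pdf big_split/= prodr_const card_ord.
by rewrite -expR_sum -mulr_sumr.
Qed.

(** [theta] is extended by 0 outside [S], so that the density formula on the whole space applies. *)
Lemma integral_iid_fvml mu kappa theta : measurable_fun S theta ->
  (\int[iid_law (fvml mu kappa) N]_(x in S) (theta x)%:E =
   \int[sigmaN]_(x in S)
     (theta x * (fvml_cst n kappa ^+ N * expR (kappa * dotp_sum mu x)))%:E)%E.
Proof.
move=> mtheta; rewrite integral_mkcond [RHS]integral_mkcond.
rewrite (integral_iid_density (mu := surface_measure R n) (measurable_fvml_pdf mu kappa)
  (fvml_pdf_ge0 mu kappa))//.
  apply: eq_integral => x _; rewrite !patchE; case: ifP => _.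
    by rewrite -EFinM tuple_density_fvml.
  by rewrite mul0e.
apply/(measurable_restrictT _ _).1; first exact: measurable_sphere_tuple.
exact/measurable_EFinP.
Qed.

(** On [S] the density is at least c = C_n(kappa)^N e^(-kappa N) > 0, so |theta| is at most 1/c
    times its product with the density. *)
Lemma integrable_iid_fvml mu kappa theta : (0 < n)%N -> sphere R n mu -> 0 < kappa ->
  measurable_fun S theta ->
  (iid_law (fvml mu kappa) N).-integrable S (EFin \o theta) ->
  sigmaN.-integrable S (EFin \o theta).
Proof.
move=> n0 mu1 k0 mtheta /integrableP[_ fin]; have mS := @measurable_sphere_tuple R n N.
pose dens x := fvml_cst n kappa ^+ N * expR (kappa * dotp_sum mu x).
have C0 : 0 < fvml_cst n kappa ^+ N by rewrite exprn_gt0// fvml_cst_gt0.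
pose c := fvml_cst n kappa ^+ N * expR (- (kappa * N%:R)).
have c0 : 0 < c by rewrite mulr_gt0// expR_gt0.
have cd x : S x -> c <= dens x.
  move=> Sx; rewrite ler_wpM2l ?(ltW C0)// ler_expR -mulrN ler_wpM2l ?(ltW k0)//.
  by have := norm_dotp_sum_le mu1 Sx; rewrite ler_norml => /andP[].
have mdens : measurable_fun S dens.
  apply: measurable_funM => //; apply: measurableT_comp => //.
  apply: measurable_funM => //; apply: measurable_funTS; exact: measurable_dotp_sum.
have id : sigmaN.-integrable S (EFin \o (fun x => theta x * dens x)).
  apply/integrableP; split; first by apply/measurable_EFinP; exact: measurable_funM.
  move: fin; rewrite (@integral_iid_fvml _ _ (fun x => `|theta x|)); last first.
    exact: measurableT_comp.
  congr (_ < _)%E; apply: eq_integral => x; rewrite inE => Sx /=.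
  by rewrite normrM (ger0_norm (le_trans (ltW c0) (cd x Sx))).
apply: (le_integrable mS _ _ (integrableZl mS c^-1 id)); first exact/measurable_EFinP.
move=> x Sx; rewrite /= lee_fin normrM [X in _ * X]normrM.
rewrite (gtr0_norm (_ : 0 < c^-1)) ?invr_gt0// mulrCA -[leLHS]mulr1 ler_wpM2l//.
by rewrite ler_pdivlMl// mulr1 (le_trans (cd _ Sx))// ler_norm.
Qed.

End fvml_sample.

(** * Analyticity of g as a function of kappa^2 *)

Lemma analytic_at_real_analytic_on (R : realType) (U : set R) (h : R -> R) :
  (forall x, U x -> analytic_at h x) -> real_analytic_on U h.
Proof. by move=> hU x /hU[r r0 [a [_ ha]]]; exists r => //; exists a. Qed.

Theorem theorem3p1 (R : realType) (n N : nat) (hn : (1 <= n)%N) (hN : (1 <= N)%N)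
  (g : R -> R)
  (hg : exists2 theta : N.-tuple 'rV[R]_n -> R,
    measurable_fun (sphere_tuple R n N) theta &
    forall (mu : 'rV[R]_n) (kappa : R), sphere R n mu -> 0 < kappa ->
      (iid_law (fvml mu kappa) N).-integrable (sphere_tuple R n N) (EFin \o theta) /\
      (\int[iid_law (fvml mu kappa) N]_(x in sphere_tuple R n N) (theta x)%:E
        = (g kappa)%:E)%E) :
  exists (U : set R) (h : R -> R),
    [/\ open U, `[0, +oo[ `<=` U, real_analytic_on U h &
      forall kappa : R, 0 < kappa -> g kappa = h (kappa ^+ 2)].
Proof.
case: hg => theta mtheta Htheta.
have mS := @measurable_sphere_tuple R n N.
(* Any fixed unit vector would do; the first basis vector exists because n >= 1. *)
pose mu : 'rV[R]_n := delta_mx 0 (Ordinal hn).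
have mu1 : sphere R n mu.
  apply/sphereP; rewrite /dotp (bigD1 (Ordinal hn))//= big1 => [|i /negPf i0].
    by rewrite !mxE !eqxx mulr1 addr0.
  by rewrite !mxE i0 andbF mulr0.
have Nmu1 : sphere R n (- mu) by rewrite /sphere/= enormN.
(* The single value kappa = 1 already gives integrability against the product surface measure. *)
have itheta := integrable_iid_fvml hn mu1 ltr01 mtheta (Htheta _ _ mu1 ltr01).1.
have mZ : measurable_fun (sphere_tuple R n N) (@dotp_sum R n N mu).
  by apply: measurable_funTS; exact: measurable_dotp_sum.
have ZN x := @norm_dotp_sum_le R n N mu x mu1.
have [c cE cI] := laplace_even mS mZ itheta ZN.
pose Phi (u : R) : R := limn (series (fun j => c j * u ^+ j)).
have cPhi u : series (fun j => c j * u ^+ j) @ \oo --> Phi u.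
  exact: entire_coef_cvg cE.
have [e e0 B0] := @bessel_sum_gt0 R n hn.
pose K : R := 2 `^ (n%:R / 2 - 1) / (2 * pi) `^ (n%:R / 2).
(* The 1/2 compensates for [Phi] being the sum, not the mean, over [mu] and [- mu]. *)
pose h (u : R) := (K ^+ N / 2) * (Phi u * (bessel_sum n u)^-1 ^+ N).
exists `](- e), +oo[%classic, h; split.
- exact: interval_open.
- move=> u /=; rewrite !in_itv/= !andbT; apply: lt_le_trans.
  by rewrite oppr_lt0.
- apply: analytic_at_real_analytic_on => u /=; rewrite in_itv/= andbT => ue.
  apply: analytic_atM; first exact: analytic_at_cst.
  apply: analytic_atM; first exact: analytic_at_entire cE cPhi u.
  apply: analytic_atX; apply: analytic_atV; first by rewrite gt_eqF// B0.
  apply: analytic_at_entire; last exact: cvg_bessel_sum.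
  exact: entire_bessel_coef.
move=> kappa k0; pose C := fvml_cst n kappa ^+ N.
have gE (m : 'rV[R]_n) : sphere R n m -> g kappa =
    C * \int[iid_law (surface_measure R n) N]_(x in sphere_tuple R n N)
      (theta x * expR (kappa * dotp_sum m x)).
  move=> m1; rewrite -RintegralZl//; last first.
    apply: (integrable_mul_bounded mS itheta (K := expR (kappa * N%:R))).
      apply: measurableT_comp => //; apply: measurable_funM => //.
      by apply: measurable_funTS; exact: measurable_dotp_sum.
    move=> x Sx; rewrite ger0_norm ?expR_ge0// ler_expR ler_wpM2l ?(ltW k0)//.
    by rewrite (le_trans (ler_norm _))// norm_dotp_sum_le.
  have [_] := Htheta _ _ m1 k0; rewrite integral_iid_fvml// => /(congr1 fine)/= <-.
  by apply: eq_Rintegral => x _; rewrite mulrCA.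
have PhiE := cvg_unique _ (cPhi (kappa ^+ 2)) (cI kappa).
(* The two copies of g(kappa) are expressed with [mu] and with [- mu]; the latter flips the sign of
   the exponent. *)
have : 2 * g kappa = C * Phi (kappa ^+ 2).
  rewrite PhiE// mulrDr mulr_natl mulr2n {1}(gE _ mu1) (gE _ Nmu1).
  congr (_ + _ * _); apply: eq_Rintegral => x _.
  by rewrite dotp_sumN mulrN.
rewrite /h /C fvml_cstE// -/K exprMn => gP.
rewrite -[LHS](mulKf (_ : 2 != 0))// gP; ring.
Qed.
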